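(* Let $(\mathfrak g,\theta,\xi)$ be any one of the ten cases in the list in the context, and let $l$ be a positive integer. Then (1) $(\theta^{[l]},\theta^{[l]})\in 1+qA$, (2) $(\theta^{[2l]},\xi^{[l]})\in 1+qA$, and (3) $(\xi^{[l]},\xi^{[l]})\in (l+1)+qA$.
   Context: Let $\mathfrak g$ have simple roots $\alpha_i$ and simple coroots $h_i$ ($i\in I$), and let $(\cdot,\cdot)$ be the invariant form with $(\alpha_i,\alpha_i)\in2\mathbb Z_{>0}$, $\langle h_i,\lambda\rangle=2(\alpha_i,\lambda)/(\alpha_i,\alpha_i)$. Put $q_i=q^{(\alpha_i,\alpha_i)/2}$, $[n]_i=(q_i^n-q_i^{-n})/(q_i-q_i^{-1})$. $U_q^-(\mathfrak g)$ is the $\mathbb Q(q)$-algebra generated by $f_i$ ($i\in I$) with the quantum Serre relations; $f_i^{(n)}=f_i^n/[n]_i!$. For $i\in I$, $e_i'$ is the $\mathbb Q(q)$-linear operator on $U_q^-(\mathfrak g)$ with $e_i'(1)=0$ and $e_i'f_j=q_i^{-\langle h_i,\alpha_j\rangle}f_je_i'+\delta_{ij}$, where $f_j$ acts by left multiplication. $(\cdot,\cdot)$ on $U_q^-(\mathfrak g)$ is the unique non-degenerate symmetric $\mathbb Q(q)$-valued bilinear form with $(1,1)=1$ and $(f_iu,v)=(u,e_i'v)$. $A\subset\mathbb Q(q)$ is the subring of rational functions regular at $q=0$. List of cases ($l\ge1$). Numbering: $A_5$ is the path $1,\dots,5$; in $B_3$ (path $1,2,3$) $\alpha_3$ is short;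 in $C_3$ (path $1,2,3$) $\alpha_3$ is long; in $D_4$ node $2$ is central; in $G_2$, $\alpha_1$ is short. 1. $A_5$: $\theta^{[l]}=(f_2^{(l)}f_4^{(l)})(f_1^{(l)}f_3^{(2l)}f_5^{(l)})(f_2^{(l)}f_4^{(l)})$, $\xi^{[l]}=(f_2^{(l)}f_4^{(l)})(f_1^{(l)}f_3^{(2l)}f_5^{(l)})(f_2^{(2l)}f_4^{(2l)})(f_1^{(l)}f_3^{(2l)}f_5^{(l)})(f_2^{(l)}f_4^{(l)})$. 2. $A_5$: $\theta^{[l]}=(f_1^{(l)}f_3^{(2l)}f_5^{(l)})(f_2^{(3l)}f_4^{(3l)})(f_1^{(l)}f_3^{(2l)}f_5^{(l)})$, $\xi^{[l]}=(f_1^{(l)}f_3^{(2l)}f_5^{(l)})(f_2^{(3l)}f_4^{(3l)})(f_1^{(2l)}f_3^{(4l)}f_5^{(2l)})(f_2^{(3l)}f_4^{(3l)})(f_1^{(l)}f_3^{(2l)}f_5^{(l)})$. 3. $B_3$: $\theta^{[l]}=f_2^{(l)}(f_1^{(l)}f_3^{(2l)})f_2^{(l)}$, $\xi^{[l]}=f_2^{(l)}(f_1^{(l)}f_3^{(2l)})f_2^{(2l)}(f_1^{(l)}f_3^{(2l)})f_2^{(l)}$. 4. $B_3$: $\theta^{[l]}=(f_1^{(l)}f_3^{(2l)})f_2^{(3l)}(f_1^{(l)}f_3^{(2l)})$, $\xi^{[l]}=(f_1^{(l)}f_3^{(2l)})f_2^{(3l)}(f_1^{(2l)}f_3^{(4l)})f_2^{(3l)}(f_1^{(l)}f_3^{(2l)})$.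 5. $C_3$: $\theta^{[l]}=f_2^{(l)}(f_1^{(l)}f_3^{(l)})f_2^{(l)}$, $\xi^{[l]}=f_2^{(l)}(f_1^{(l)}f_3^{(l)})f_2^{(2l)}(f_1^{(l)}f_3^{(l)})f_2^{(l)}$. 6. $C_3$: $\theta^{[l]}=(f_1^{(l)}f_3^{(l)})f_2^{(3l)}(f_1^{(l)}f_3^{(l)})$, $\xi^{[l]}=(f_1^{(l)}f_3^{(l)})f_2^{(3l)}(f_1^{(2l)}f_3^{(2l)})f_2^{(3l)}(f_1^{(l)}f_3^{(l)})$. 7. $D_4$: $\theta^{[l]}=f_2^{(l)}(f_1^{(l)}f_3^{(l)}f_4^{(l)})f_2^{(l)}$, $\xi^{[l]}=f_2^{(l)}(f_1^{(l)}f_3^{(l)}f_4^{(l)})f_2^{(2l)}(f_1^{(l)}f_3^{(l)}f_4^{(l)})f_2^{(l)}$. 8. $D_4$: $\theta^{[l]}=(f_1^{(l)}f_3^{(l)}f_4^{(l)})f_2^{(3l)}(f_1^{(l)}f_3^{(l)}f_4^{(l)})$, $\xi^{[l]}=(f_1^{(l)}f_3^{(l)}f_4^{(l)})f_2^{(3l)}(f_1^{(2l)}f_3^{(2l)}f_4^{(2l)})f_2^{(3l)}(f_1^{(l)}f_3^{(l)}f_4^{(l)})$. 9. $G_2$: $\theta^{[l]}=f_1^{(l)}f_2^{(l)}f_1^{(l)}$, $\xi^{[l]}=f_1^{(l)}f_2^{(l)}f_1^{(2l)}f_2^{(l)}f_1^{(l)}$. 10. $G_2$: $\theta^{[l]}=f_2^{(l)}f_1^{(3l)}f_2^{(l)}$,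 $\xi^{[l]}=f_2^{(l)}f_1^{(3l)}f_2^{(2l)}f_1^{(3l)}f_2^{(l)}$. *)

(* Defs.v *)
From HB Require Import structures.
From mathcomp Require Import all_boot all_order all_algebra.
From mathcomp Require Import boolp sesquilinear.
From mathcomp Require Import monalg.

Set Implicit Arguments.
Unset Strict Implicit.
Unset Printing Implicit Defensive.

Import GRing.Theory.

Local Open Scope ring_scope.
Local Open Scope quotient_scope.

Definition Qq : fieldType := {fraction {poly rat}}.

Definition q : Qq := tofrac 'X.

Definition regular0 (x : Qq) : Prop :=
  exists num den : {poly rat}, den.[0] != 0 /\ x = tofrac num / tofrac den.

(* [mod_qA c x] means that x lies in the coset c + qA. *)
Definition mod_qA (c x : Qq) : Prop := exists2 a, regular0 a & x = c + q * a.

(* The form on the root lattice, given by its values (alpha_i, alpha_j); the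
   Cartan matrix has entries a i j = <h_i, alpha_j>.  The normalization is left
   free: any with all (alpha_i, alpha_i) in 2Z_{>0} is allowed. *)
Record invariant_form n (a : 'M[int]_n) := InvariantForm {
  bil :> 'M[int]_n;
  bil_sym : forall i j, bil i j = bil j i;
  bil_diag : forall i, exists2 m : nat, (0 < m)%N & bil i i = 2 * m%:Z;
  bil_cartan : forall i j, a i j * bil i i = 2 * bil i j
}.

Lemma malg_scaleAr (K : monomType) (R : comNzRingType) (c : R)
  (x y : {malg R[K]}) : c *: (x * y) = x * (c *: y).
Proof.
apply/malgP => k; rewrite mcoeffZ mcoeffMl.
rewrite (mcoeffMlw _ (d1 := msupp x) _ (msuppZ_le c y)) // mulr_sumr.
apply: eq_bigr => k1 _; rewrite mulr_sumr; apply: eq_bigr => k2 _.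
by rewrite mcoeffZ mulrnAr mulrCA.
Qed.

Section QuantumGroup.

Variables (n : nat) (a : 'M[int]_n) (b : invariant_form a).

Definition q_ (i : 'I_n) : Qq := q ^ (b i i %/ 2)%Z.

Definition qint (i : 'I_n) (m : nat) : Qq :=
  (q_ i ^+ m - q_ i ^- m) / (q_ i - (q_ i)^-1).

Definition qfact (i : 'I_n) (m : nat) : Qq := \prod_(1 <= k < m.+1) qint i k.

Local Notation freeAlg := {malg Qq[{fmonom 'I_n}]}.

Definition gen (i : 'I_n) : freeAlg := << fmu i >>.

Definition gen_divpow (i : 'I_n) (m : nat) : freeAlg :=
  (qfact i m)^-1 *: gen i ^+ m.

(* For i != j, `|1 - a i j| = 1 - <h_i, alpha_j>. *)
Definition serre (i j : 'I_n) : freeAlg :=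
  let m := `|1 - a i j|%N in
  \sum_(k < m.+1)
    (-1) ^+ k *: (gen_divpow i k * gen j * gen_divpow i (m - k)%N).

(* The two-sided ideal of the free algebra generated by the Serre elements. *)
Inductive serre_ideal : freeAlg -> Prop :=
| serre_ideal0 : serre_ideal 0
| serre_idealD u v i j x : i != j -> serre_ideal x ->
    serre_ideal (u * serre i j * v + x).

Definition serre_pred : {pred freeAlg} := fun x => `[< serre_ideal x >].

Lemma serre_predP x : reflect (serre_ideal x) (x \in serre_pred).
Proof. exact: asboolP. Qed.

Lemma serre_ideal_add x y :
  serre_ideal x -> serre_ideal y -> serre_ideal (x + y).
Proof.
move=> Ix Iy; elim: Ix => [|u v i j z ij _ IH]; first by rewrite add0r.
by rewrite -addrA; apply: serre_idealD.
Qed.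

Lemma serre_ideal_mull w x : serre_ideal x -> serre_ideal (w * x).
Proof.
elim=> [|u v i j z ij _ IH]; first by rewrite mulr0; apply: serre_ideal0.
by rewrite mulrDr !mulrA; apply: serre_idealD.
Qed.

Lemma serre_ideal_mulr w x : serre_ideal x -> serre_ideal (x * w).
Proof.
elim=> [|u v i j z ij _ IH]; first by rewrite mul0r; apply: serre_ideal0.
by rewrite mulrDl -mulrA; apply: serre_idealD.
Qed.

Lemma serre_ideal_opp x : serre_ideal x -> serre_ideal (- x).
Proof. by rewrite -mulN1r; apply: serre_ideal_mull. Qed.

Lemma serre_ideal_scale c x : serre_ideal x -> serre_ideal (c *: x).
Proof. by rewrite -[x in c *: x]mul1r scalerAl; apply: serre_ideal_mull. Qed.

Fact serre_zmod_closed : zmod_closed serre_pred.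
Proof.
split=> [|x y /serre_predP Ix /serre_predP Iy]; apply/serre_predP.
  exact: serre_ideal0.
exact/serre_ideal_add/serre_ideal_opp.
Qed.

HB.instance Definition _ :=
  GRing.isZmodClosed.Build freeAlg serre_pred serre_zmod_closed.

Definition Uqm := Quotient.quot serre_pred.

HB.instance Definition _ := GRing.Zmodule.on Uqm.

(* The Serre elements have no constant term, whence 1 != 0 in the quotient. *)
Fact serre_ideal_mcoeff1 (x : freeAlg) : serre_ideal x -> x@_mone = 0.
Proof.
have gen0 i : (gen i)@_mone = 0 :> Qq.
  by rewrite mcoeffU1; case: eqP => // /(congr1 (@fdeg _)); rewrite fdegU fdeg1.
elim=> [|u v i j z ij _ IH]; first by rewrite mcoeff0.
rewrite mcoeffD IH addr0 !rmorphM /=.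
suff -> : (serre i j)@_mone = 0 :> Qq by rewrite mulr0 mul0r.
rewrite raddf_sum big1 //= => k _.
by rewrite mcoeffZ !rmorphM /= gen0 mulr0 mul0r mulr0.
Qed.

Local Notation pi := (\pi_Uqm : freeAlg -> Uqm).

Lemma Uqm_eq (x y : freeAlg) : reflect (pi x = pi y) (x - y \in serre_pred).
Proof. by rewrite Quotient.idealrBE; apply: eqP. Qed.

Lemma Uqm_repr (x : freeAlg) : repr (pi x) - x \in serre_pred.
Proof. by apply/Uqm_eq; rewrite reprK. Qed.

Lemma Uqm_ind (P : Uqm -> Prop) : (forall x, P (pi x)) -> forall u, P u.
Proof. by move=> Ppi u; rewrite -[u]reprK. Qed.

Definition Uqm_one : Uqm := pi 1.
Definition Uqm_mul (x y : Uqm) : Uqm := pi (repr x * repr y).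
Definition Uqm_scale (c : Qq) (x : Uqm) : Uqm := pi (c *: repr x).

Fact pi_mul (x y : freeAlg) : Uqm_mul (pi x) (pi y) = pi (x * y).
Proof.
apply/Uqm_eq/serre_predP.
have -> : repr (pi x) * repr (pi y) - x * y =
    (repr (pi x) - x) * repr (pi y) + x * (repr (pi y) - y).
  by rewrite mulrBl mulrBr addrA subrK.
apply: serre_ideal_add.
  exact/serre_ideal_mulr/serre_predP/Uqm_repr.
exact/serre_ideal_mull/serre_predP/Uqm_repr.
Qed.

Fact pi_scale c (x : freeAlg) : Uqm_scale c (pi x) = pi (c *: x).
Proof.
apply/Uqm_eq/serre_predP; rewrite -scalerBr.
exact/serre_ideal_scale/serre_predP/Uqm_repr.
Qed.

Fact pi_add (x y : freeAlg) : pi x + pi y = pi (x + y).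
Proof. by rewrite Quotient.pi_add. Qed.

Fact Uqm_mulA : associative Uqm_mul.
Proof.
elim/Uqm_ind=> x; elim/Uqm_ind=> y; elim/Uqm_ind=> z.
by rewrite !pi_mul mulrA.
Qed.

Fact Uqm_mul1 : left_id Uqm_one Uqm_mul.
Proof. by elim/Uqm_ind=> x; rewrite pi_mul mul1r. Qed.

Fact Uqm_mulr1 : right_id Uqm_one Uqm_mul.
Proof. by elim/Uqm_ind=> x; rewrite pi_mul mulr1. Qed.

Fact Uqm_mulDl : left_distributive Uqm_mul +%R.
Proof.
elim/Uqm_ind=> x; elim/Uqm_ind=> y; elim/Uqm_ind=> z.
by rewrite !(pi_add, pi_mul) mulrDl.
Qed.

Fact Uqm_mulDr : right_distributive Uqm_mul +%R.
Proof.
elim/Uqm_ind=> x; elim/Uqm_ind=> y; elim/Uqm_ind=> z.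
by rewrite !(pi_add, pi_mul) mulrDr.
Qed.

Fact Uqm_one_neq0 : Uqm_one != 0.
Proof.
apply/eqP => E.
have /Uqm_eq : pi 1 = pi 0.
  by rewrite [LHS]E; apply: (@addrI _ (pi 0)); rewrite pi_add !addr0.
rewrite subr0 => /serre_predP/serre_ideal_mcoeff1/eqP.
by rewrite mcoeff1 eqxx oner_eq0.
Qed.

HB.instance Definition _ := GRing.Zmodule_isNzRing.Build Uqm
  Uqm_mulA Uqm_mul1 Uqm_mulr1 Uqm_mulDl Uqm_mulDr Uqm_one_neq0.

Fact Uqm_scaleA c d x : Uqm_scale c (Uqm_scale d x) = Uqm_scale (c * d) x.
Proof. by elim/Uqm_ind: x => x; rewrite !pi_scale scalerA. Qed.

Fact Uqm_scale1 : left_id 1 Uqm_scale.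
Proof. by elim/Uqm_ind=> x; rewrite pi_scale scale1r. Qed.

Fact Uqm_scaleDr : right_distributive Uqm_scale +%R.
Proof.
move=> c; elim/Uqm_ind=> x; elim/Uqm_ind=> y.
by rewrite !(pi_add, pi_scale) scalerDr.
Qed.

Fact Uqm_scaleDl x : {morph Uqm_scale^~ x : c d / c + d}.
Proof. by move=> c d; elim/Uqm_ind: x => x; rewrite !pi_scale pi_add scalerDl. Qed.

HB.instance Definition _ := GRing.Zmodule_isLmodule.Build Qq Uqm
  Uqm_scaleA Uqm_scale1 Uqm_scaleDr Uqm_scaleDl.

Fact Uqm_scaleAl (c : Qq) (x y : Uqm) : c *: (x * y) = c *: x * y.
Proof.
elim/Uqm_ind: x => x; elim/Uqm_ind: y => y.
by rewrite [LHS](congr1 _ (pi_mul _ _)) [LHS]pi_scale scalerAl -pi_mul -pi_scale.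
Qed.

HB.instance Definition _ := GRing.Lmodule_isLalgebra.Build Qq Uqm Uqm_scaleAl.

Fact Uqm_scaleAr (c : Qq) (x y : Uqm) : c *: (x * y) = x * (c *: y).
Proof.
elim/Uqm_ind: x => x; elim/Uqm_ind: y => y.
by rewrite [LHS](congr1 _ (pi_mul _ _)) [LHS]pi_scale malg_scaleAr -pi_mul
  -pi_scale.
Qed.

HB.instance Definition _ := GRing.Lalgebra_isAlgebra.Build Qq Uqm Uqm_scaleAr.

Definition f (i : 'I_n) : Uqm := pi (gen i).

Definition divpow (i : 'I_n) (m : nat) : Uqm := (qfact i m)^-1 *: f i ^+ m.

Definition kashiwara_operators (e' : 'I_n -> {linear Uqm -> Uqm}) : Prop :=
  (forall i, e' i 1 = 0) /\
  (forall i j u, e' i (f j * u) =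
     q_ i ^ (- a i j) *: (f j * e' i u) + (i == j)%:R *: u).

Definition kashiwara_form (e' : 'I_n -> {linear Uqm -> Uqm})
    (B : {biscalar Uqm}) : Prop :=
  [/\ forall u v, B u v = B v u,
      forall u, (forall v, B u v = 0) -> u = 0,
      B 1 1 = 1 &
      forall i u v, B (f i * u) v = B u (e' i v)].

End QuantumGroup.

Inductive dynkin := A5 | B3 | C3 | D4 | G2.

Definition rank (t : dynkin) : nat :=
  match t with A5 => 5 | B3 => 3 | C3 => 3 | D4 => 4 | G2 => 2 end.

(* Node number k of the diagram, counted from 1. *)
Definition node (t : dynkin) : nat -> 'I_(rank t) :=
  match t with
  | A5 => fun k => inord k.-1
  | B3 => fun k => inord k.-1
  | C3 => fun k => inord k.-1
  | D4 => fun k => inord k.-1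
  | G2 => fun k => inord k.-1
  end.

(* The entry in row i and column j is <h_i, alpha_j>: alpha_3 is short in B3 and
   long in C3, node 2 is central in D4, alpha_1 is short in G2. *)
Definition cartan_rows (t : dynkin) : seq (seq int) :=
  match t with
  | A5 => [:: [::  2; -1;  0;  0;  0];
              [:: -1;  2; -1;  0;  0];
              [::  0; -1;  2; -1;  0];
              [::  0;  0; -1;  2; -1];
              [::  0;  0;  0; -1;  2]]
  | B3 => [:: [::  2; -1;  0];
              [:: -1;  2; -1];
              [::  0; -2;  2]]
  | C3 => [:: [::  2; -1;  0];
              [:: -1;  2; -2];
              [::  0; -1;  2]]
  | D4 => [:: [::  2; -1;  0;  0];
              [:: -1;  2; -1; -1];
              [::  0; -1;  2;  0];
              [::  0; -1;  0;  2]]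
  | G2 => [:: [::  2; -3];
              [:: -1;  2]]
  end.

Definition cartan (t : dynkin) : 'M[int]_(rank t) :=
  \matrix_(i, j) nth 0 (nth [::] (cartan_rows t) i) j.

Inductive example :=
  A5a | A5b | B3a | B3b | C3a | C3b | D4a | D4b | G2a | G2b.

Definition diagram (c : example) : dynkin :=
  match c with
  | A5a | A5b => A5
  | B3a | B3b => B3
  | C3a | C3b => C3
  | D4a | D4b => D4
  | G2a | G2b => G2
  end.

(* A pair (k, m) stands for the divided power f_k^(m). *)
Definition theta_word (c : example) (l : nat) : seq (nat * nat) :=
  match c with
  | A5a =>
      [:: (2, l); (4, l);
          (1, l); (3, 2 * l); (5, l);
          (2, l); (4, l)]
  | A5b =>
      [:: (1, l); (3, 2 * l); (5, l);
          (2, 3 * l); (4, 3 * l);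
          (1, l); (3, 2 * l); (5, l)]
  | B3a =>
      [:: (2, l);
          (1, l); (3, 2 * l);
          (2, l)]
  | B3b =>
      [:: (1, l); (3, 2 * l);
          (2, 3 * l);
          (1, l); (3, 2 * l)]
  | C3a =>
      [:: (2, l);
          (1, l); (3, l);
          (2, l)]
  | C3b =>
      [:: (1, l); (3, l);
          (2, 3 * l);
          (1, l); (3, l)]
  | D4a =>
      [:: (2, l);
          (1, l); (3, l); (4, l);
          (2, l)]
  | D4b =>
      [:: (1, l); (3, l); (4, l);
          (2, 3 * l);
          (1, l); (3, l); (4, l)]
  | G2a =>
      [:: (1, l);
          (2, l);
          (1, l)]
  | G2b =>
      [:: (2, l);
          (1, 3 * l);
          (2, l)]
  end%N.

Definition xi_word (c : example) (l : nat) : seq (nat * nat) :=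
  match c with
  | A5a =>
      [:: (2, l); (4, l);
          (1, l); (3, 2 * l); (5, l);
          (2, 2 * l); (4, 2 * l);
          (1, l); (3, 2 * l); (5, l);
          (2, l); (4, l)]
  | A5b =>
      [:: (1, l); (3, 2 * l); (5, l);
          (2, 3 * l); (4, 3 * l);
          (1, 2 * l); (3, 4 * l); (5, 2 * l);
          (2, 3 * l); (4, 3 * l);
          (1, l); (3, 2 * l); (5, l)]
  | B3a =>
      [:: (2, l);
          (1, l); (3, 2 * l);
          (2, 2 * l);
          (1, l); (3, 2 * l);
          (2, l)]
  | B3b =>
      [:: (1, l); (3, 2 * l);
          (2, 3 * l);
          (1, 2 * l); (3, 4 * l);
          (2, 3 * l);
          (1, l); (3, 2 * l)]
  | C3a =>
      [:: (2, l);
          (1, l); (3, l);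
          (2, 2 * l);
          (1, l); (3, l);
          (2, l)]
  | C3b =>
      [:: (1, l); (3, l);
          (2, 3 * l);
          (1, 2 * l); (3, 2 * l);
          (2, 3 * l);
          (1, l); (3, l)]
  | D4a =>
      [:: (2, l);
          (1, l); (3, l); (4, l);
          (2, 2 * l);
          (1, l); (3, l); (4, l);
          (2, l)]
  | D4b =>
      [:: (1, l); (3, l); (4, l);
          (2, 3 * l);
          (1, 2 * l); (3, 2 * l); (4, 2 * l);
          (2, 3 * l);
          (1, l); (3, l); (4, l)]
  | G2a =>
      [:: (1, l);
          (2, l);
          (1, 2 * l);
          (2, l);
          (1, l)]
  | G2b =>
      [:: (2, l);
          (1, 3 * l);
          (2, 2 * l);
          (1, 3 * l);
          (2, l)]
  end%N.

Definition word_monomial t (b : invariant_form (cartan t))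
    (w : seq (nat * nat)) : Uqm b :=
  \prod_(p <- w) divpow b (node t p.1) p.2.

Definition theta (c : example) (b : invariant_form (cartan (diagram c)))
    (l : nat) : Uqm b :=
  word_monomial b (theta_word c l).

Definition xi (c : example) (b : invariant_form (cartan (diagram c)))
    (l : nat) : Uqm b :=
  word_monomial b (xi_word c l).

(* Main.v *)
(* Moving divided powers from left to right with e_i'^(a) f_j^(b) gives
     (f_{i_1}^(a_1) ... f_{i_r}^(a_r), f_{j_1}^(b_1) ... f_{j_s}^(b_s)) =
       sum over M of q^Q(M) * prod (f_{i_k}^(M_kl), f_{i_k}^(M_kl)),
   where M runs over the matrices of natural numbers with row sums a_k and column
   sums b_l supported on i_k = j_l, and Q is an explicit quadratic form. The factors
   (f_i^(m), f_i^(m)) lie in 1 + qA, so if Q >= 0 on these matrices then the value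
   is congruent to the number of zeros of Q.
   In all ten cases Q is a positive combination of rescaled copies of the form of
   G_2, one for each edge of the diagram (for A_5 the middle node is shared by two
   edges at half its multiplicity, and so on; this is the folding of D_4 in
   disguise). For G_2 the form is visibly nonnegative: for (xi, xi), if b, c, g, h
   are the entries X_12, X_13, X_31, X_32 of the 3 x 3 matrix of the node occurring
   three times and y is the off-diagonal entry for the other node, then up to scale
     2Q = 3 (2y - b - h)^2 + (b - h)^2 + 4bc + 4gh + 2c^2 + 2g^2 + 2(c - g)^2.
   Its zeros form a segment with l + 1 integral points. *)

Require Import Defs.
From mathcomp Require Import all_boot all_order all_algebra.
From mathcomp Require Import sesquilinear.
From mathcomp Require Import ring zify.

Set Implicit Arguments.
Unset Strict Implicit.
Unset Printing Implicit Defensive.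

Import Order.TTheory GRing.Theory Num.Theory.

Local Open Scope ring_scope.

(** * Residues at q = 0 *)

Lemma q_neq0 : q != 0.
Proof. by rewrite /q tofrac_eq0 polyX_eq0. Qed.

Lemma regular0_tofrac p : regular0 (tofrac p).
Proof.
by exists p, 1; rewrite hornerC oner_eq0 tofrac1 divr1.
Qed.

Lemma den_neq0 (d : {poly rat}) : d.[0] != 0 -> tofrac d != 0 :> Qq.
Proof. by rewrite tofrac_eq0; apply: contra => /eqP->; rewrite horner0. Qed.

Lemma regular0D x y : regular0 x -> regular0 y -> regular0 (x + y).
Proof.
move=> [n1 [d1 [h1 ->]]] [n2 [d2 [h2 ->]]].
exists (n1 * d2 + n2 * d1), (d1 * d2); split; first by rewrite hornerM mulf_neq0.
by rewrite tofracD !tofracM addf_div // den_neq0.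
Qed.

Lemma regular0M x y : regular0 x -> regular0 y -> regular0 (x * y).
Proof.
move=> [n1 [d1 [h1 ->]]] [n2 [d2 [h2 ->]]].
exists (n1 * n2), (d1 * d2); split; first by rewrite hornerM mulf_neq0.
by rewrite !tofracM mulf_div.
Qed.

Lemma regular0_nat m : regular0 m%:R.
Proof. by rewrite -(rmorph_nat (@tofrac {poly rat})); apply: regular0_tofrac. Qed.

Lemma mod_qA_const m : mod_qA m%:R m%:R.
Proof. by exists 0; [apply: (regular0_nat 0) | rewrite mulr0 addr0]. Qed.

Lemma mod_qA11 : mod_qA 1 1.
Proof. by have := mod_qA_const 1; rewrite mulr1n. Qed.

Lemma mod_qA00 : mod_qA 0 0.
Proof. by have := mod_qA_const 0; rewrite mulr0n. Qed.

Lemma mod_qA_regular m x : mod_qA m%:R x -> regular0 x.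
Proof.
by move=> [a ha ->]; apply/regular0D/regular0M => //;
  [apply: regular0_nat | apply: regular0_tofrac].
Qed.

Lemma mod_qAD c d x y : mod_qA c x -> mod_qA d y -> mod_qA (c + d) (x + y).
Proof.
move=> [a ha ->] [b hb ->]; exists (a + b); first exact: regular0D.
by rewrite mulrDr addrACA.
Qed.

Lemma mod_qAM1 x y : mod_qA 1 x -> mod_qA 1 y -> mod_qA 1 (x * y).
Proof.
move=> hx [b hb ->]; move: (mod_qA_regular (m := 1) hx) => rx.
case: hx => [a ha xE]; exists (a + x * b); first exact/regular0D/regular0M.
by rewrite mulrDr mulr1 {1}xE mulrDr addrA mulrCA.
Qed.

Lemma mod_qAM0 x y : mod_qA 0 x -> mod_qA 1 y -> mod_qA 0 (x * y).
Proof.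
move=> [a ha ->] /(mod_qA_regular (m := 1)) hy; exists (a * y); first exact: regular0M.
by rewrite !add0r mulrA.
Qed.

Lemma inv1D_quot (F : fieldType) (x n d : F) : d != 0 -> d + x * n != 0 ->
  (1 + x * (n / d))^-1 = 1 + x * (- n / (d + x * n)).
Proof.
move=> d0 e0.
have -> : 1 + x * (n / d) = (d + x * n) / d by field.
by rewrite invf_div; field.
Qed.

(** The inverse of 1 + q n/d has denominator d + X n, whose value at 0 is that of d. *)
Lemma mod_qA1V x : mod_qA 1 x -> mod_qA 1 x^-1.
Proof.
move=> [_ [n [d [hd ->]]] ->].
have h2 : (d + 'X * n).[0] != 0.
  by rewrite hornerD hornerM hornerX mul0r addr0.
exists (- tofrac n / tofrac (d + 'X * n)).
  by exists (- n), (d + 'X * n); rewrite tofracN.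
move: (den_neq0 hd) (den_neq0 h2); rewrite tofracD tofracM -/q.
exact: inv1D_quot.
Qed.

Lemma mod_qA_exp_gt0 m : (0 < m)%N -> mod_qA 0 (q ^+ m).
Proof.
case: m => // m _; exists (q ^+ m); last by rewrite add0r exprS.
by rewrite /q -rmorphXn; apply: regular0_tofrac.
Qed.

(** * Divided powers of the Kashiwara operators *)

Section QuantumIntegers.

Variables (F : fieldType) (v : F).

(* Locked: rewriting with the laws of multiplication would otherwise unfold it. *)
Definition qnum (m : nat) : F := locked ((v ^+ m - v ^- m) / (v - v^-1)).

Lemma qnumE m : qnum m = (v ^+ m - v ^- m) / (v - v^-1).
Proof. by rewrite /qnum -lock. Qed.

Definition qfactorial (m : nat) : F := \prod_(1 <= k < m.+1) qnum k.

(* The value of the form at (f_i^(m), f_i^(m)), for v = q_i. *)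
Definition divpow_norm (m : nat) : F :=
  \prod_(1 <= k < m.+1) (v ^+ k.-1 * qnum k)^-1.

(* The coefficient of f^(b-c) e'^(a-c) in e'^(a) f^(b), see [epow_dpow]. *)
Definition expand_coef (a b c : nat) : F :=
  if (c <= a)%N then
    v ^ (- (2 * a * b)%:Z + (c * (a + b))%:Z) * divpow_norm c
  else 0.

Lemma qfactorialS m : qfactorial m.+1 = qfactorial m * qnum m.+1.
Proof. by rewrite /qfactorial big_nat_recr. Qed.

Lemma qfactorial0 : qfactorial 0 = 1.
Proof. by rewrite /qfactorial big_nil. Qed.

Lemma divpow_norm0 : divpow_norm 0 = 1.
Proof. by rewrite /divpow_norm big_nil. Qed.

Lemma divpow_normS m :
  divpow_norm m.+1 = divpow_norm m * (v ^+ m * qnum m.+1)^-1.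
Proof. by rewrite /divpow_norm big_nat_recr. Qed.

Lemma qnum0 : qnum 0 = 0.
Proof. by rewrite !qnumE expr0 invr1 subrr mul0r. Qed.

Hypothesis qnum_neq0 : forall m, qnum m.+1 != 0.

Lemma v_neq0 : v != 0.
Proof.
apply: contra_neq (qnum_neq0 0); rewrite !qnumE => ->.
by rewrite expr1 invr0 subrr mul0r.
Qed.

Lemma vB_neq0 : v - v^-1 != 0.
Proof. by apply: contra_neq (qnum_neq0 0); rewrite !qnumE => ->; rewrite invr0 mulr0. Qed.

Lemma qnumD c d : qnum (c + d) = v ^+ c * qnum d + v ^- d * qnum c.
Proof.
rewrite !qnumE !exprD !invfM; have v0 := v_neq0.
have := expf_neq0 c v0; have := expf_neq0 d v0; rewrite !mulrA -mulrDl => d0 c0.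
congr (_ / _).
set x := v ^+ c; set y := v ^+ d; ring.
Qed.

(* The induction step for 1 + v^-2 + ... + v^-2m = v^-m [m+1]. *)
Lemma qnumS_geom m :
  1 + v ^- 2 * (v ^- m * qnum m.+1) = v ^- m.+1 * qnum m.+2.
Proof.
have v0 := v_neq0; have := expf_neq0 m v0; move: vB_neq0 (vB_neq0).
(* [field] needs v^2 - 1 != 0, which is read off from the nonzero v - v^-1. *)
rewrite -{1}[v - v^-1](_ : (v ^+ 2 - 1) / v = _); last first.
  by rewrite expr2; field.
rewrite mulf_eq0 negb_or invr_eq0 => /andP[h1 _] h0 w0.
rewrite !qnumE !exprS expr0; field.
by rewrite -expr2 v0 w0 h1.
Qed.

Lemma expand_coef00 b : expand_coef 0 b 0 = 1.
Proof. by rewrite /expand_coef /= muln0 mul0n expr0z divpow_norm0 mulr1. Qed.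

Lemma expand_coefS0 a b :
  qnum a.+1 * expand_coef a.+1 b 0 = expand_coef a b 0 * v ^- (2 * b) * qnum a.+1.
Proof.
rewrite /expand_coef /= !mul0n !addr0 mulrC; congr (_ * _).
rewrite exprnN mulrAC -expfzDr ?v_neq0 //.
by congr (_ ^ _ * _); lia.
Qed.

(** Both sides are the coefficient of f^(b-c-1) e'^(a-c) in e' e'^(a) f^(b): on the right, e' either
    passes f^(b-c-1) or lowers f^(b-c). Splitting a+1 as (c+1) + (a-c) in [qnumD] separates the
    two. *)
Lemma expand_coefSS a b c : (c < b)%N ->
  qnum a.+1 * expand_coef a.+1 b c.+1 =
    expand_coef a b c.+1 * v ^- (2 * (b - c.+1)) * qnum (a - c) +
    expand_coef a b c * v ^- (b - c.+1).
Proof.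
move=> cb; rewrite /expand_coef ltnS; case: (leqP c a) => ca; last first.
  by rewrite leqNgt ltnS (ltnW ca) /= !mulr0 !mul0r addr0.
have v0 := v_neq0.
(* For c = a the guard of [expand_coef] gives 0, but so does the factor [a - c], and the case
   distinction disappears. *)
have -> : (if (c < a)%N then v ^ (- (2 * a * b)%:Z + (c.+1 * (a + b))%:Z) *
    divpow_norm c.+1 else 0) * v ^- (2 * (b - c.+1)) * qnum (a - c) =
  v ^ (- (2 * a * b)%:Z + (c.+1 * (a + b))%:Z) * divpow_norm c.+1 *
    v ^- (2 * (b - c.+1)) * qnum (a - c).
  case: ltnP => // ac; have -> : (a - c = 0)%N by lia.
  by rewrite qnum0 !mulr0.
have -> : divpow_norm c = divpow_norm c.+1 * (v ^ c * qnum c.+1).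
  by rewrite divpow_normS -mulrA mulVf ?mulr1 // mulf_neq0 // expf_neq0.
have -> : qnum a.+1 = v ^ c.+1 * qnum (a - c) + v ^ (- (a - c)%:Z) * qnum c.+1.
  by rewrite -exprnN -exprnP -qnumD addSn subnKC.
rewrite !exprnN mulrDl; congr (_ + _).
  set x := divpow_norm _; set y := qnum _.
  set k1 := v ^ _; set k2 := v ^ _; set k3 := v ^ _; set k4 := v ^ _.
  have -> : k1 * y * (k2 * x) = (k1 * k2) * (x * y) by ring.
  have -> : k3 * x * k4 * y = (k3 * k4) * (x * y) by ring.
  rewrite /k1 /k2 /k3 /k4 -!expfzDr //; congr (_ ^ _ * _).
  by rewrite !PoszM -(subzn cb) !PoszD !intS; ring.
set x := divpow_norm _; set y := qnum _.
set k1 := v ^ _; set k2 := v ^ _; set k3 := v ^ _; set k4 := v ^ _; set k5 := v ^ _.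
have -> : k1 * y * (k2 * x) = (k1 * k2) * (x * y) by ring.
have -> : k3 * (x * (k4 * y)) * k5 = (k3 * k4 * k5) * (x * y) by ring.
rewrite /k1 /k2 /k3 /k4 /k5 -!expfzDr //; congr (_ ^ _ * _).
by rewrite -(subzn cb) -(subzn ca) !PoszM !PoszD !intS; ring.
Qed.

End QuantumIntegers.

Section QBoson.

Variables (F : fieldType) (U : algType F) (I : eqType).
Variables (f : I -> U) (e : I -> {linear U -> U}).
Variables (s : I -> F) (t : I -> I -> F).

Hypothesis s_qnum : forall i m, qnum (s i) m.+1 != 0.
Hypothesis tii : forall i, t i i = s i ^- 2.
Hypothesis e1 : forall i, e i 1 = 0.
Hypothesis eM : forall i j u,
  e i (f j * u) = t i j *: (f j * e i u) + (i == j)%:R *: u.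

Definition dpow (i : I) (m : nat) : U := (qfactorial (s i) m)^-1 *: f i ^+ m.

Definition epow (i : I) (m : nat) (u : U) : U :=
  (qfactorial (s i) m)^-1 *: iter m (e i) u.

Lemma dpow0 i : dpow i 0 = 1.
Proof. by rewrite /dpow qfactorial0 invr1 scale1r expr0. Qed.

Lemma epow0 i u : epow i 0 u = u.
Proof. by rewrite /epow qfactorial0 invr1 scale1r. Qed.

Lemma e_epow i m u : e i (epow i m u) = qnum (s i) m.+1 *: epow i m.+1 u.
Proof.
rewrite /epow linearZ /= scalerA qfactorialS invfM mulrCA mulfV ?mulr1 //.
Qed.

Lemma epow1 i m : epow i m 1 = (m == 0%N)%:R.
Proof.
case: m => [|m]; first by rewrite epow0.
by rewrite /epow iterSr e1 (_ : iter _ _ _ = 0) ?scaler0 //; elim: m => //= m ->;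
  rewrite linear0.
Qed.

(** Passing m+1 factors f_i, the operator can remove any of them, with weights 1, s^-2, ..., s^-2m,
    whose sum is s^-m [m+1]. *)
Lemma e_expr i m u :
  e i (f i ^+ m.+1 * u) = s i ^- (2 * m.+1) *: (f i ^+ m.+1 * e i u) +
    (s i ^- m * qnum (s i) m.+1) *: (f i ^+ m * u).
Proof.
have q1 : qnum (s i) 1 = 1.
  have := vB_neq0 (s_qnum i); rewrite qnumE expr1; exact: mulfV.
elim: m => [|m IH].
  by rewrite expr1 expr0 mul1r eM tii eqxx q1 invr1 mulr1 muln1.
rewrite {1}exprS -mulrA eM IH eqxx scale1r tii mulrDr scalerDr -!scalerAr !scalerA.
rewrite ![f i * (_ * _)]mulrA -!exprS -invfM -exprD -addrA; congr (_ + _).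
  by congr (_ ^- _ *: _); lia.
rewrite -[X in _ + X]scale1r -scalerDl; congr (_ *: _).
by rewrite -(qnumS_geom (s_qnum i)) addrC.
Qed.

Lemma e_dpow i m u :
  e i (dpow i m.+1 * u) = s i ^- (2 * m.+1) *: (dpow i m.+1 * e i u) +
    s i ^- m *: (dpow i m * u).
Proof.
rewrite /dpow -!scalerAl linearZ /= e_expr scalerDr !scalerA.
congr (_ *: _ + _ *: _); first by rewrite mulrC.
rewrite qfactorialS invfM mulrCA -!mulrA; congr (_ * _).
by rewrite mulVf ?mulr1.
Qed.

Lemma e_dpow_neq i j m u : i != j ->
  e i (dpow j m * u) = t i j ^+ m *: (dpow j m * e i u).
Proof.
move=> ij; rewrite /dpow -!scalerAl linearZ /= scalerA mulrC -scalerA.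
congr (_ *: _); elim: m => [|m IH]; first by rewrite !expr0 !mul1r scale1r.
by rewrite exprS -mulrA eM (negPf ij) scale0r addr0 IH -scalerAr scalerA mulrA -exprS.
Qed.

Lemma epow_dpow_neq i j a m u : i != j ->
  epow i a (dpow j m * u) = t i j ^+ (a * m) *: (dpow j m * epow i a u).
Proof.
move=> ij; elim: a => [|a IH]; first by rewrite mul0n expr0 scale1r !epow0.
apply: (scalerI (s_qnum i a)); rewrite -e_epow IH linearZ /= e_dpow_neq //.
by rewrite e_epow -scalerAr !scalerA -exprD mulrC mulSn addnC.
Qed.

(** Induction on [a]: by [e_dpow], one more e_i either passes f_i^(m-c) or lowers it to
    f_i^(m-c-1). *)
Lemma epow_dpow i a m u :
  epow i a (dpow i m * u) =
    \sum_(c < m.+1) expand_coef (s i) a m c *: (dpow i (m - c) * epow i (a - c) u).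
Proof.
elim: a => [|a IH].
  rewrite big_ord_recl big1 ?addr0 => [|c _].
    by rewrite expand_coef00 subn0 !epow0 scale1r.
  by rewrite /expand_coef /= scale0r.
apply: (scalerI (s_qnum i a)); rewrite -e_epow IH linear_sum /=.
rewrite scaler_sumr [RHS]big_ord_recl /= scalerA expand_coefS0 //.
(* For c = m no f_i is left to be lowered, hence the shorter second sum. *)
transitivity (\sum_(c < m.+1) ((expand_coef (s i) a m c * s i ^- (2 * (m - c)) *
     qnum (s i) (a - c).+1) *: (dpow i (m - c) * epow i (a - c).+1 u)) +
   \sum_(c < m) (expand_coef (s i) a m c * s i ^- (m - c.+1)) *:
      (dpow i (m - c.+1) * epow i (a - c) u)).
  rewrite [in LHS]big_ord_recr [X in _ = X + _]big_ord_recr /= addrAC -big_split /=.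
  congr (_ + _).
    apply: eq_bigr => c _; have cm : (m - c = (m - c.+1).+1)%N by have := ltn_ord c; lia.
    rewrite linearZ /= cm e_dpow scalerDr e_epow -scalerAr !scalerA -cm.
    by congr (_ *: _ + _); ring.
  rewrite subnn dpow0 !mul1r linearZ /= e_epow scalerA.
  by rewrite muln0 expr0 invr1 mulr1.
rewrite [X in X + _]big_ord_recl /= !subn0 -addrA; congr (_ + _).
rewrite -big_split /=; apply: eq_bigr => c _; have cm := ltn_ord c.
rewrite /bump /= !add1n scalerA expand_coefSS // subSS scalerDl.
(* For c >= a the truncated (a - c.+1).+1 differs from a - c, but the coefficient in front of it is
   0. *)
have [ca|ca] := ltnP c a; last first.
  have -> : (a - c = 0)%N by lia.
  by rewrite /expand_coef ltnNge ca /= !mul0r !scale0r.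
by have -> : (a - c = (a - c.+1).+1)%N by lia.
Qed.

Variable B : U -> U -> F.
Hypothesis BZl : forall x u v, B (x *: u) v = x * B u v.
Hypothesis BZr : forall x u v, B u (x *: v) = x * B u v.
Hypothesis Be : forall i u v, B (f i * u) v = B u (e i v).

Lemma B_dpowl i m u v : B (dpow i m * u) v = B u (epow i m v).
Proof.
rewrite /dpow /epow -scalerAl BZl BZr; congr (_ * _).
elim: m u v => [|m IH] u v; first by rewrite mul1r.
by rewrite exprS -mulrA Be IH -iterSr.
Qed.

End QBoson.

(** * The form on monomials as a sum over matrices *)

Definition word := seq (nat * nat).

(** A filter on the range 0..b of the sum in [epow_dpow], with the guard of [expand_coef] as
    condition, so that the two sums match term by term. *)
Definition parts (a b : nat) := [seq c <- index_iota 0 b.+1 | (c <= a)%N].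

(* A row lists its entries only in the columns that carry the same node [i]. *)
Fixpoint splits (i a : nat) (w : word) : seq (seq nat) :=
  if w is (j, b) :: w' then
    if i == j then
      [seq c :: r | c <- parts a b, r <- splits i (a - c) w']
    else splits i a w'
  else if a == 0%N then [:: [::]] else [::].

(** The word left behind once the operator at node [i] has absorbed the entries of [r]: the column
    sums for the remaining rows. *)
Fixpoint residue (i : nat) (w : word) (r : seq nat) : word :=
  if w is (j, b) :: w' then
    if eqn i j then (j, (b - head 0 r)%N) :: residue i w' (behead r)
    else (j, b) :: residue i w' r
  else [::].

(* The matrices of natural numbers with rows indexed by [w1] and columns by [w2],
   supported on pairs of equal nodes, whose row and column sums are the
   multiplicities. *)
Fixpoint mats (w1 w2 : word) : seq (seq (seq nat)) :=
  if w1 is (i, a) :: w1' then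
    [seq r :: M | r <- splits i a w2, M <- mats w1' (residue i w2 r)]
  else if all (fun p => p.2 == 0)%N w2 then [:: [::]] else [::].

Lemma splits_cons i a j b w : splits i a ((j, b) :: w) =
  if i == j then [seq c :: r | c <- parts a b, r <- splits i (a - c) w]
  else splits i a w.
Proof. by []. Qed.

Lemma cons_pairs_uniq (T : eqType) (s : seq T) (t : T -> seq (seq T)) :
  uniq s -> (forall x, uniq (t x)) -> uniq [seq x :: y | x <- s, y <- t x].
Proof.
move=> us ut.
apply: (@allpairs_uniq_dep T (fun=> seq T : eqType) _ (fun x (y : seq T) => x :: y)) => //.
by move=> [c r] [c' r'] _ _ /= [-> ->].
Qed.

Lemma splits_uniq i a w : uniq (splits i a w).
Proof.
elim: w a => [|[j b] w IH] a; first by rewrite /=; case: ifP.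
by rewrite splits_cons; case: ifP => // _; apply: cons_pairs_uniq => //;
  rewrite filter_uniq // iota_uniq.
Qed.

Lemma mats_uniq w1 w2 : uniq (mats w1 w2).
Proof.
elim: w1 w2 => [|[i a] w1 IH] w2 /=; first by case: ifP.
by apply: cons_pairs_uniq => // ; apply: splits_uniq.
Qed.

Section Exponents.

Variables (hh : nat -> int) (kap : nat -> nat -> int).

(** The power of v collected by e_i^(a) on its way through [w]: that of [expand_coef] at each letter
    of node i, where c units of a are used up, and that of t(i, j)^(ab) at the others. *)
Fixpoint rowexp (i a : nat) (w : word) (r : seq nat) : int :=
  if w is (j, b) :: w' then
    if i == j then
      let c := head 0%N r in
      hh i * (- (2 * a * b)%:Z + (c * (a + b))%:Z) + rowexp i (a - c) w' (behead r)
    else - kap i j * (a * b)%:Z + rowexp i a w' r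
  else 0.

Fixpoint matexp (w1 w2 : word) (M : seq (seq nat)) : int :=
  if w1 is (i, a) :: w1' then
    rowexp i a w2 (head [::] M) +
    matexp w1' (residue i w2 (head [::] M)) (behead M)
  else 0.

Definition zword := seq (nat * int).

Definition word_int (w : word) : zword := [seq (p.1, p.2%:Z) | p <- w].

(* Continuation-passing enumeration of [splits], with the partial remainders
   as fresh variables instead of truncated differences. *)
Fixpoint row_all (i : nat) (a : int) (w : zword)
    (K : seq int -> zword -> int -> Prop) : Prop :=
  if w is (j, b) :: w' then
    if eqn i j then
      forall c a' b' : int, 0 <= c -> a = c + a' -> b = c + b' ->
      row_all i a' w' (fun r u e =>
        K (c :: r) ((j, b') :: u) (- hh i * (c * a' + c * b' + 2 * (a' * b')) + e))
    else row_all i a w' (fun r u e => K r ((j, b) :: u) (- kap i j * (a * b) + e))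
  else a = 0 -> K [::] [::] 0.

Fixpoint null_all (w : zword) (P : Prop) : Prop :=
  if w is (_, b) :: w' then b = 0 -> null_all w' P else P.

Fixpoint mat_all (w1 w2 : zword) (K : seq (seq int) -> int -> Prop) : Prop :=
  if w1 is (i, a) :: w1' then
    row_all i a w2 (fun r u e => mat_all w1' u (fun M e' => K (r :: M) (e + e')))
  else null_all w2 (K [::] 0).

Lemma row_allP i a w K : row_all i a%:Z (word_int w) K ->
  forall r, r \in splits i a w ->
  K (map Posz r) (word_int (residue i w r)) (rowexp i a w r).
Proof.
elim: w a K => [|[j b] w IH] a K; [rewrite /= | rewrite splits_cons].
  by case: eqP => [->|_] H r; rewrite ?inE // => /eqP->; apply: H.
rewrite [row_all _ _ _ _]/= -[eqn i j]/(i == j); case ij: (i == j) => H r hr; last first.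
  by rewrite /= eqnE ij; apply: (IH _ (fun r u e => K r _ (_ + e))) H _ hr.
case/allpairsPdep: hr => c [r' [hc hr ->]]; rewrite /= eqnE ij.
move: hc; rewrite mem_filter mem_index_iota ltnS => /andP[ca /= cb].
have -> : - (2 * a * b)%:Z + (c * (a + b))%:Z =
  - ((c%:Z * (a - c)%:Z + c%:Z * (b - c)%:Z + 2 * ((a - c)%:Z * (b - c)%:Z))) :> int.
  by rewrite -(subzn ca) -(subzn cb) !PoszM !PoszD; ring.
rewrite mulrN -mulNr.
apply: (IH _ (fun r u e => K (_ :: r) (_ :: u) (_ + e))) hr.
by apply: H => //; rewrite -PoszD subnKC.
Qed.

Lemma mat_allP w1 w2 K : mat_all (word_int w1) (word_int w2) K ->
  forall M, M \in mats w1 w2 -> K (map (map Posz) M) (matexp w1 w2 M).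
Proof.
elim: w1 w2 K => [|[i a] w1 IH] w2 K /= H M.
  case: ifP => // hw; rewrite inE => /eqP ->.
  elim: w2 hw H => //= -[j b] w2 IH2 /andP[/eqP/= -> hw] H; apply: IH2 => //; exact: H.
case/allpairsPdep => r [M' [hr hM ->]] /=.
by apply: (IH _ (fun M e => K (_ :: M) (_ + e))) hM; apply: (row_allP H).
Qed.

End Exponents.

Section Pairing.

Variables (F : fieldType) (U : algType F) (I : eqType).
Variables (f : I -> U) (e : I -> {linear U -> U}).
Variables (s : I -> F) (t : I -> I -> F).

Hypothesis s_qnum : forall i m, qnum (s i) m.+1 != 0.
Hypothesis tii : forall i, t i i = s i ^- 2.
Hypothesis e1 : forall i, e i 1 = 0.
Hypothesis eM : forall i j u,
  e i (f j * u) = t i j *: (f j * e i u) + (i == j)%:R *: u.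

Variable B : U -> U -> F.
Hypothesis BDr : forall u v w, B u (v + w) = B u v + B u w.
Hypothesis BZl : forall x u v, B (x *: u) v = x * B u v.
Hypothesis BZr : forall x u v, B u (x *: v) = x * B u v.
Hypothesis Be : forall i u v, B (f i * u) v = B u (e i v).
Hypothesis BC : forall u v, B u v = B v u.
Hypothesis B11 : B 1 1 = 1.

Variables (L : pred nat) (nd : nat -> I) (v : F).
Variables (hh : nat -> int) (kap : nat -> nat -> int).
Hypothesis v0 : v != 0.
Hypothesis nd_inj : {in L &, injective nd}.
Hypothesis sE : forall i, L i -> s (nd i) = v ^ hh i.
Hypothesis tE : forall i j, L i -> L j -> t (nd i) (nd j) = v ^ (- kap i j).

Definition wmon (w : word) : U := \prod_(p <- w) dpow f s (nd p.1) p.2.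

Definition row_wt (i : nat) (r : seq nat) : F :=
  \prod_(c <- r) divpow_norm (s (nd i)) c.

Fixpoint mat_wt (w : word) (M : seq (seq nat)) : F :=
  if w is (i, _) :: w' then row_wt i (head [::] M) * mat_wt w' (behead M) else 1.

Local Notation inL := (all (fun p => L p.1)).

Lemma inL_residue i w r : inL w -> inL (residue i w r).
Proof. by elim: w r => //= -[j b] w IH r /= /andP[hj /IH hw]; case: ifP => /=; rewrite hj hw. Qed.

(** The operator moves through the letters by [epow_dpow] and [epow_dpow_neq]. What survives at the
    end meets e_i 1 = 0, so a row must use up all of [a]. *)
Lemma epow_wmon i a w : L i -> inL w ->
  epow e s (nd i) a (wmon w) =
    \sum_(r <- splits i a w) (v ^ rowexp hh kap i a w r * row_wt i r) *:
      wmon (residue i w r).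
Proof.
move=> Li; elim: w a => [|[j b] w IH] a; [rewrite /= | rewrite splits_cons].
  move=> _; rewrite /wmon big_nil epow1 //; case: eqP => _; last by rewrite big_nil.
  by rewrite big_seq1 /row_wt !big_nil expr0z mulr1 scale1r.
case/andP=> Lj Lw; rewrite {1}/wmon big_cons -/(wmon w) [(_, _).1]/= [(_, _).2]/=.
case: eqP => [ij|/eqP ij].
  rewrite -ij (epow_dpow s_qnum tii eM) big_allpairs_dep /= big_filter.
  rewrite -(big_mkord xpredT (fun c =>
    expand_coef _ a b c *: (dpow _ _ _ (b - c) * epow _ _ _ (a - c) _))).
  rewrite [RHS]big_mkcond; apply: eq_bigr => c _.
  rewrite /expand_coef; case: ifP => ca; last by rewrite scale0r.
  rewrite IH // mulr_sumr scaler_sumr; apply: eq_bigr => r _.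
  rewrite /= eqnE eqxx -scalerAr scalerA /wmon big_cons /=; congr (_ *: _).
  by rewrite sE // exprz_exp expfzDr // /row_wt big_cons sE // mulrACA.
have nij : nd i != nd j by apply: contra ij => /eqP/nd_inj ->.
rewrite (epow_dpow_neq s_qnum eM) // IH // mulr_sumr scaler_sumr; apply: eq_bigr => r _.
rewrite /= eqnE (negPf ij) -scalerAr scalerA /wmon big_cons /=; congr (_ *: _).
by rewrite tE // exprnP exprz_exp expfzDr // mulrA.
Qed.

(** By symmetry a leading f^(b) can be moved across as e^(b), which kills 1 unless b = 0. *)
Lemma B1_wmon w : B 1 (wmon w) = (all (fun p => p.2 == 0)%N w)%:R.
Proof.
elim: w => [|[j b] w IH] /=; first by rewrite /wmon big_nil B11.
rewrite /wmon big_cons BC (B_dpowl s BZl BZr Be) epow1 // BC.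
by case: eqP => _ /=; rewrite -?IH // -[0%:R](scale0r 1) BZl mul0r.
Qed.

(** Each letter of [w1] becomes an operator on the second argument and produces one row; in the end
    the columns must be exhausted. *)
Lemma B_wmon w1 w2 : inL w1 -> inL w2 ->
  B (wmon w1) (wmon w2) =
    \sum_(M <- mats w1 w2) v ^ matexp hh kap w1 w2 M * mat_wt w1 M.
Proof.
have B0r u : B u 0 = 0 by rewrite -(scale0r 0) BZr mul0r.
elim: w1 w2 => [|[i a] w1 IH] w2 /=.
  move=> _ _; rewrite {1}/wmon big_nil B1_wmon; case: ifP => _.
    by rewrite big_seq1 expr0z mulr1.
  by rewrite big_nil.
case/andP=> Li Lw1 Lw2; rewrite {1}/wmon big_cons -/(wmon w1) /= (B_dpowl s BZl BZr Be).
rewrite epow_wmon // (big_morph _ (BDr _) (B0r _)) big_allpairs_dep /=.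
apply: eq_bigr => r _; rewrite BZr IH ?inL_residue // mulr_sumr.
by apply: eq_bigr => M _; rewrite expfzDr // mulrACA.
Qed.

End Pairing.

(** * Decomposition of the exponent into pairs of neighbouring nodes *)

Section Linearity.

Variable L : pred nat.
Local Notation inL := (all (fun p : nat * nat => L p.1)).

(** The exponent is linear in (h, kap), and kap enters at distinct nodes only. The scale D avoids
    fractions. *)
Lemma rowexp_linear (T : Type) (s : seq T) (x : T -> int) (h : T -> nat -> int)
    (k : T -> nat -> nat -> int) D h0 k0 i a w r :
  (forall i, L i -> D * h0 i = \sum_(d <- s) x d * h d i) ->
  (forall i j, L i -> L j -> i != j -> D * k0 i j = \sum_(d <- s) x d * k d i j) ->
  L i -> inL w ->
  D * rowexp h0 k0 i a w r = \sum_(d <- s) x d * rowexp (h d) (k d) i a w r.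
Proof.
move=> hE kE Li; elim: w a r => [|[j b] w IH] a r /=.
  by move=> _; rewrite mulr0 big1 // => d _; rewrite mulr0.
case/andP=> Lj Lw; case: eqP => [ij|/eqP ij].
  under eq_bigr do rewrite mulrDr mulrA.
  by rewrite big_split /= -mulr_suml -hE // mulrDr IH // mulrA.
under eq_bigr do rewrite mulrDr mulrA mulrN mulNr.
by rewrite big_split /= sumrN -mulr_suml -kE // mulrDr IH // mulNr mulrN mulrA.
Qed.

Lemma matexp_linear (T : Type) (s : seq T) (x : T -> int) (h : T -> nat -> int)
    (k : T -> nat -> nat -> int) D h0 k0 w1 w2 M :
  (forall i, L i -> D * h0 i = \sum_(d <- s) x d * h d i) ->
  (forall i j, L i -> L j -> i != j -> D * k0 i j = \sum_(d <- s) x d * k d i j) ->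
  inL w1 -> inL w2 ->
  D * matexp h0 k0 w1 w2 M = \sum_(d <- s) x d * matexp (h d) (k d) w1 w2 M.
Proof.
move=> hE kE; elim: w1 w2 M => [|[i a] w1 IH] w2 M /=.
  by move=> _ _; rewrite mulr0 big1 // => d _; rewrite mulr0.
case/andP=> Li Lw1 Lw2; under eq_bigr do rewrite mulrDr.
by rewrite big_split /= -(rowexp_linear _ _ hE kE) // mulrDr IH // inL_residue.
Qed.

End Linearity.

Section Restriction.

(* [rho] forgets the nodes that it sends to [None] and renames the others. *)
Variable rho : nat -> option nat.
Hypothesis rho_inj : forall i j k, rho i = Some k -> rho j = Some k -> i = j.

Fixpoint restr (w : word) : word :=
  if w is (i, a) :: w' then
    if rho i is Some k then (k, a) :: restr w' else restr w'
  else [::].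

Fixpoint restr_rows (w : word) (M : seq (seq nat)) : seq (seq nat) :=
  match w, M with
  | (i, _) :: w', r :: M' =>
    if rho i is Some _ then r :: restr_rows w' M' else restr_rows w' M'
  | _, _ => [::]
  end.

Lemma rho_eq i j k k' : rho i = Some k -> rho j = Some k' -> (k == k') = (i == j).
Proof.
move=> hi hj; apply/eqP/eqP => [E|E]; first by apply: rho_inj hi _; rewrite hj E.
by move: hi; rewrite E hj => -[].
Qed.

Lemma restr_splits i k a w : rho i = Some k -> splits k a (restr w) = splits i a w.
Proof.
move=> hi; elim: w a => [|[j b] w IH] a //; rewrite [restr _]/= splits_cons.
case hj: (rho j) => [k'|].
  rewrite splits_cons (rho_eq hi hj); case: ifP => // _.
  by congr flatten; apply: eq_map => c; rewrite IH.
by case: eqP => [E|_]; rewrite ?IH //; rewrite -E hi in hj.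
Qed.

Lemma restr_residue i k w r : rho i = Some k ->
  restr (residue i w r) = residue k (restr w) r.
Proof.
move=> hi; elim: w r => [|[j b] w IH] r //=; rewrite !eqnE.
case hj: (rho j) => [k'|] /=; rewrite ?eqnE.
  by rewrite (rho_eq hi hj); case: ifP => _ /=; rewrite hj IH.
by case: eqP => [E|_] /=; [rewrite -E hi in hj | rewrite hj IH].
Qed.

Lemma restr_residue_none i w r : rho i = None -> restr (residue i w r) = restr w.
Proof.
move=> hi; elim: w r => [|[j b] w IH] r //=; rewrite !eqnE.
case: eqP => [<-|_] /=; first by rewrite hi.
by rewrite IH.
Qed.

Lemma restr_null w : all (fun p => p.2 == 0%N) w ->
  all (fun p => p.2 == 0%N) (restr w).
Proof.
by elim: w => //= -[j b] w IH /andP[b0 /IH hw]; case: (rho j) => //= k; rewrite b0.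
Qed.

(** Row and column sums involve one node at a time, so forgetting the other nodes preserves them. *)
Lemma restr_mats w1 w2 M :
  M \in mats w1 w2 -> restr_rows w1 M \in mats (restr w1) (restr w2).
Proof.
elim: w1 w2 M => [|[i a] w1 IH] w2 M.
  by rewrite /=; case: ifP => // /restr_null ->.
rewrite [mats _ _]/= => /allpairsPdep[r [M' [hr /IH hM ->]]] /=.
case hi: (rho i) => [k|] /=; last by rewrite (restr_residue_none _ _ hi) in hM.
apply/allpairsPdep; exists r, (restr_rows w1 M'); split=> //.
  by rewrite (restr_splits _ _ hi).
by rewrite -(restr_residue _ _ hi).
Qed.

Variables (h : nat -> int) (kap : nat -> nat -> int).

Definition pull_symmetrizer (i : nat) : int := oapp h 0 (rho i).

Definition pull_form (i j : nat) : int := oapp (fun k => oapp (kap k) 0 (rho j)) 0 (rho i).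

Lemma restr_rowexp i k a w r : rho i = Some k ->
  rowexp pull_symmetrizer pull_form i a w r = rowexp h kap k a (restr w) r.
Proof.
move=> hi; elim: w a r => [|[j b] w IH] a r //=.
case hj: (rho j) => [k'|] /=.
  rewrite (rho_eq hi hj); case: eqP => [E|_]; first by rewrite IH /pull_symmetrizer hi.
  by rewrite IH /pull_form hi hj.
case: eqP => [E|_]; first by rewrite -E hi in hj.
by rewrite IH /pull_form hi hj /= oppr0 mul0r add0r.
Qed.

Lemma restr_rowexp_none i a w r : rho i = None -> rowexp pull_symmetrizer pull_form i a w r = 0.
Proof.
move=> hi; elim: w a r => [|[j b] w IH] a r //=.
by rewrite !IH /pull_symmetrizer /pull_form hi /= oppr0 !mul0r !addr0 if_same.
Qed.

(** The pulled-back form is zero on the forgotten nodes, so their rows and columns contribute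
    nothing. *)
Lemma restr_matexp w1 w2 M : size M = size w1 ->
  matexp pull_symmetrizer pull_form w1 w2 M = matexp h kap (restr w1) (restr w2) (restr_rows w1 M).
Proof.
elim: w1 w2 M => [|[i a] w1 IH] w2 [|r M] //= [sM].
case hi: (rho i) => [k|] /=; rewrite IH //.
  by rewrite (restr_rowexp _ _ _ hi) (restr_residue _ _ hi).
by rewrite restr_rowexp_none // add0r restr_residue_none.
Qed.

End Restriction.

Lemma size_mats w1 w2 M : M \in mats w1 w2 -> size M = size w1.
Proof.
elim: w1 w2 M => [|[i a] w1 IH] w2 M; rewrite [mats _ _]/=.
  by case: ifP => // _; rewrite inE => /eqP->.
by case/allpairsPdep => r [M' [_ /IH hM ->]]; rewrite /= hM.
Qed.

(** * Two nodes *)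

(* Two nodes 0 and 1, with multiplicities in units of p and s. *)
Definition edge_theta_word (p s l : nat) : word := [:: (0, p * l); (1, s * l); (0, p * l)]%N.

Definition edge_xi_word (p s l : nat) : word :=
  [:: (0, p * l); (1, s * l); (0, 2 * (p * l)); (1, s * l); (0, p * l)]%N.

Lemma half_sum_ge0 (e u v : int) : 0 <= u -> 0 <= v -> 2 * e = 3 * u + v ->
  0 <= e /\ (e = 0 -> u = 0 /\ v = 0).
Proof. by move=> u0 v0 uv; split; lia. Qed.

Lemma weighted_sum6_eq0 (u1 u2 u3 u4 u5 u6 : int) :
  0 <= u1 -> 0 <= u2 -> 0 <= u3 -> 0 <= u4 -> 0 <= u5 -> 0 <= u6 ->
  u1 + 4 * u2 + 4 * u3 + 2 * u4 + 2 * u5 + 2 * u6 = 0 ->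
  [/\ u1 = 0, u4 = 0 & u5 = 0].
Proof. by move=> *; split; lia. Qed.

(* The form of G_2 after the change of scale X -> X / p, Y -> Y / s in the two
   matrices, with denominators cleared; p = s = 1 is G2a, and p = 1, s = 3 is
   three times G2b. *)
Definition edge_sym (p s : nat) (k : nat) : int :=
  if k is 0%N then s%:Z ^+ 2 else 3 * p%:Z ^+ 2.

Definition edge_offdiag (p s : nat) (k k' : nat) : int := - (3 * p%:Z * s%:Z).

Definition edge_theta_theta (p s l : nat) : seq (seq nat) :=
  [:: [:: p * l; 0]; [:: s * l]; [:: 0; p * l]]%N.

Definition edge_theta_xi (p s l : nat) : seq (seq nat) :=
  [:: [:: p * l; p * l; 0]; [:: s * l; s * l]; [:: 0; p * l; p * l]]%N.

(** A segment of matrices, from the diagonal one at [t = 0] to one with vanishing diagonal at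
    [t = l]. *)
Definition edge_xi_xi (p s l t : nat) : seq (seq nat) :=
  [:: [:: p * (l - t); p * t; 0]; [:: s * (l - t); s * t];
      [:: p * t; 2 * (p * (l - t)); p * t];
      [:: s * t; s * (l - t)]; [:: 0; p * t; p * (l - t)]]%N.

(* Replaces the multiplicities by variables, so that the equations produced by
   [mat_all] can be substituted; [is_mult] hides an equation from [subst]. *)
Definition is_mult (n a : int) := n = a.

Fixpoint gen_all (w : zword) (K : zword -> Prop) : Prop :=
  if w is (i, a) :: w' then forall n, is_mult n a -> gen_all w' (fun u => K ((i, n) :: u))
  else K [::].

Lemma gen_allP w K : gen_all w K -> K w.
Proof. by elim: w K => //= -[i a] w IH K /(_ a erefl) /IH. Qed.

(* Names the entries x, x0, x1, ..., row by row. *)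
Ltac intro_mats :=
  cbn [gen_all word_int edge_theta_word edge_xi_word map fst snd
    mat_all row_all null_all eqn edge_sym];
  repeat match goal with
  | |- forall n, is_mult n _ -> _ =>
     let n := fresh "n" in let H := fresh "mult" in intros n H
  | |- forall c a' b' : int, is_true (0 <= c) -> ?a = _ -> ?b = _ -> _ =>
     let x := fresh "x" in let H0 := fresh "ge0" in
     let H1 := fresh in let H2 := fresh in
     intros x ? ? H0 H1 H2; subst a b
  | |- ?a = 0 -> _ => let H1 := fresh in intros H1; subst a
  end;
  unfold is_mult in *.

Definition zero_locus h kap (w1 w2 : word) (Z : seq (seq nat) -> Prop) :=
  {in mats w1 w2, forall M,
    0 <= matexp h kap w1 w2 M /\ (matexp h kap w1 w2 M = 0 <-> Z M)}.

(** The entries become integer variables subject to the equations for the sums, so that ring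
    identities and linear arithmetic apply. *)
Lemma zero_locus_gen h kap w1 w2 (Z : seq (seq nat) -> Prop) (Z' : seq (seq int) -> Prop) :
  (forall M, Z' (map (map Posz) M) <-> Z M) ->
  gen_all (word_int w1) (fun u1 => gen_all (word_int w2) (fun u2 =>
    mat_all h kap u1 u2 (fun M e => 0 <= e /\ (e = 0 <-> Z' M)))) ->
  zero_locus h kap w1 w2 Z.
Proof.
by move=> ZE /gen_allP/gen_allP/mat_allP H M /H [e0 eP]; rewrite eP ZE.
Qed.

Lemma inj_map_Posz : injective (map (map Posz)).
Proof. by apply/inj_map/inj_map => x y []. Qed.

Ltac exponent_is r :=
  match goal with |- is_true (0 <= ?e) /\ _ =>
    let E := fresh in assert (E : e = r); [ unfold edge_offdiag | rewrite E; clear E ] end.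

Ltac entrywise := repeat apply: (congr2 cons); first [reflexivity | lia].

Lemma edge_theta_theta_locus p s l : (0 < p)%N -> (0 < s)%N -> (0 < l)%N ->
  zero_locus (edge_sym p s) (edge_offdiag p s) (edge_theta_word p s l) (edge_theta_word p s l)
    (fun M => M = edge_theta_theta p s l).
Proof.
move=> p0 s0 l0.
apply: (@zero_locus_gen _ _ _ _ _ (fun M => M = map (map Posz) (edge_theta_theta p s l))).
  by move=> M; split=> [/inj_map_Posz|->].
intro_mats.
(* The corner entry [x0] is the only free one; the sums determine the others. *)
exponent_is (2 * s%:Z ^+ 2 * (x0 * (x0 + (p * l)%:Z))).
  have -> : x = (p * l)%:Z - x0 by lia.
  have -> : x1 = (s * l)%:Z by lia.
  have -> : x2 = x0 by lia.
  have -> : x3 = (p * l)%:Z - x0 by lia.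
  by rewrite !PoszM; ring.
have s2 : 0 < 2 * s%:Z ^+ 2 by rewrite mulr_gt0 // exprn_gt0.
have pl : (0 < p * l)%N by rewrite muln_gt0 p0.
split; first by rewrite pmulr_rge0 // mulr_ge0 // addr_ge0.
rewrite /edge_theta_theta /=; split=> [/eqP|[_ -> _ _ _]]; last by rewrite mul0r mulr0.
rewrite mulf_eq0 gt_eqF //= mulf_eq0 => /orP[] /eqP E; last lia.
entrywise.
Qed.

Lemma edge_theta_xi_locus p s l : (0 < p)%N -> (0 < s)%N -> (0 < l)%N ->
  zero_locus (edge_sym p s) (edge_offdiag p s) (edge_theta_word p s (2 * l)) (edge_xi_word p s l)
    (fun M => M = edge_theta_xi p s l).
Proof.
move=> p0 s0 l0.
apply: (@zero_locus_gen _ _ _ _ _ (fun M => M = map (map Posz) (edge_theta_xi p s l))).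
  by move=> M; split=> [/inj_map_Posz|->].
intro_mats.
exponent_is (2 * s%:Z ^+ 2 * (x0 * x4 + x1 ^+ 2 + (p * l)%:Z * x1)).
  have -> : x = 2 * (p * l)%:Z - x0 - x1 by lia.
  have -> : x2 = (s * l)%:Z by lia.
  have -> : x3 = (s * l)%:Z by lia.
  have -> : x4 = x0 + x1 - (p * l)%:Z by lia.
  have -> : x5 = 2 * (p * l)%:Z - x0 by lia.
  have -> : x6 = (p * l)%:Z - x1 by lia.
  by rewrite !PoszM; ring.
have s2 : 0 < 2 * s%:Z ^+ 2 by rewrite mulr_gt0 // exprn_gt0.
have pl : (0 < p * l)%N by rewrite muln_gt0 p0.
have a1 : 0 <= x0 * x4 by rewrite mulr_ge0.
have a2 : 0 <= x1 ^+ 2 by rewrite exprn_ge0.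
have a3 : 0 <= (p * l)%:Z * x1 by rewrite mulr_ge0.
split; first by rewrite pmulr_rge0 // !addr_ge0.
rewrite /edge_theta_xi /=; split=> [/eqP|[_ _ -> _ _ -> _ _]]; last by ring.
rewrite mulf_eq0 gt_eqF //= => /eqP E.
have /eqP : (p * l)%:Z * x1 = 0 by lia.
rewrite mulf_eq0 gt_eqF //= => /eqP E1.
have /eqP : x0 * x4 = 0 by lia.
(* [x0 = 0] would make the entry [x4] equal to - p l, which is negative. *)
by rewrite mulf_eq0 => /orP[] /eqP E2; [lia | entrywise].
Qed.

(** Completing squares as for G_2 forces c = g = 0, b = h and p y = s b at a zero. As p and s are
    coprime, b = p t and y = s t, and t parametrizes the segment. *)
Lemma edge_xi_xi_locus p s l : (0 < p)%N -> (0 < s)%N -> coprime p s ->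
  zero_locus (edge_sym p s) (edge_offdiag p s) (edge_xi_word p s l) (edge_xi_word p s l)
    (fun M => exists2 t, (t <= l)%N & M = edge_xi_xi p s l t).
Proof.
move=> p0 s0 ps.
apply: (@zero_locus_gen _ _ _ _ _
    (fun M => exists2 t, (t <= l)%N & M = map (map Posz) (edge_xi_xi p s l t))).
  by move=> M; split=> -[t tl]; [move/inj_map_Posz=> ->|move=> ->]; exists t.
intro_mats.
(* In the notation of the G_2 form, [x0], [x1], [x9], [x10] are b, c, g, h and [x3] is y; these five
   entries determine the others. *)
exponent_is (2 * (s%:Z ^+ 2 * (x0 ^+ 2 + x0 * x10 + x10 ^+ 2 + x0 * x1 + x9 * x10 +
    x1 ^+ 2 - x1 * x9 + x9 ^+ 2) - 3 * p%:Z * s%:Z * (x0 + x10) * x3 +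
    3 * p%:Z ^+ 2 * x3 ^+ 2)).
  have -> : x = (p * l)%:Z - x0 - x1 by lia.
  have -> : x2 = (s * l)%:Z - x3 by lia.
  have -> : x7 = x3 by lia.
  have -> : x8 = (s * l)%:Z - x3 by lia.
  have -> : x4 = x0 + x1 - x9 by lia.
  have -> : x5 = 2 * (p * l)%:Z - x0 - x10 by lia.
  have -> : x6 = x10 + x9 - x1 by lia.
  have -> : x11 = (p * l)%:Z - x9 - x10 by lia.
  by rewrite !PoszM; ring.
set e := (X in 0 <= X).
(* On the two main terms, b^2 + bh + h^2 = 3/4 (b + h)^2 + 1/4 (b - h)^2. *)
have eE : 2 * e = 3 * (2 * (p%:Z * x3) - s%:Z * (x0 + x10)) ^+ 2 +
  s%:Z ^+ 2 * ((x0 - x10) ^+ 2 + 4 * (x0 * x1) + 4 * (x9 * x10) + 2 * x1 ^+ 2 +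
            2 * x9 ^+ 2 + 2 * (x1 - x9) ^+ 2) by rewrite /e; ring.
have s2 : 0 < s%:Z ^+ 2 by rewrite exprn_gt0.
have a0 := sqr_ge0 (2 * (p%:Z * x3) - s%:Z * (x0 + x10)).
have a1 := sqr_ge0 (x0 - x10).
have a2 : 0 <= x0 * x1 by rewrite mulr_ge0.
have a3 : 0 <= x9 * x10 by rewrite mulr_ge0.
have a4 := sqr_ge0 x1.
have a5 := sqr_ge0 x9.
have a6 := sqr_ge0 (x1 - x9).
set G := (X in s%:Z ^+ 2 * X) in eE.
have G0 : 0 <= G by rewrite /G !addr_ge0 // mulr_ge0.
have sG : 0 <= s%:Z ^+ 2 * G by rewrite pmulr_rge0.
have [e_ge0 e_eq0] := half_sum_ge0 a0 sG eE.
split=> //.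
rewrite -/e /edge_xi_xi /=; split=> [e0|[t _ [_ h0 h1 _ h3 _ _ _ _ _ h9 h10 _]]]; last first.
  suff : 2 * e = 0 by move=> /eqP; rewrite mulf_eq0 => /eqP.
  by rewrite eE /G h0 h1 h3 h9 h10 !PoszM; ring.
have [/eqP b0 /eqP] := e_eq0 e0.
rewrite mulf_eq0 gt_eqF //= /G => /eqP G00.
have [/eqP b10 /eqP b1 /eqP b9] := weighted_sum6_eq0 a1 a2 a3 a4 a5 a6 G00.
move: b0 b1 b9 b10; rewrite !sqrf_eq0 => /eqP b0 /eqP b1 /eqP b9 /eqP b10.
clear e eE e_ge0 e_eq0 e0 G G0 sG G00 a0 a1 a2 a3 a4 a5 a6.
have hy : p%:Z * x3 = s%:Z * x0.
  apply: (@mulfI _ (2 : int)) => //; rewrite (subr0_eq b0) (_ : x10 = x0); first by ring.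
  by clear -b10; lia.
have [n0 xn] : exists n : nat, x0 = n by case: (x0) ge1 => // n' _; exists n'.
have [n3 yn] : exists n : nat, x3 = n by case: (x3) ge4 => // n' _; exists n'.
have hn : (p * n3 = s * n0)%N by move: hy; rewrite xn yn; lia.
have /dvdnP[t nt] : (p %| n0)%N by rewrite -(Gauss_dvdr _ ps) -hn dvdn_mulr.
have n3t : (n3 = s * t)%N.
  by apply/eqP; rewrite -(eqn_pmul2l p0) hn nt [X in X == _]mulnA [X in X == _]mulnC.
have tl : (t <= l)%N by rewrite -(leq_pmul2l p0); lia.
exists t => //; rewrite !mulnBr; have ptl : (p * t <= p * l)%N by rewrite leq_mul2l tl orbT.
have stl : (s * t <= s * l)%N by rewrite leq_mul2l tl orbT.
by entrywise.
Qed.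

(** * The ten cases *)

Definition labels (t : dynkin) : pred nat := [pred k | 0 < k <= rank t]%N.

(** The smallest integral choice of (alpha_i, alpha_i) / 2, equal to 1 on the short roots. *)
Definition symmetrizer (t : dynkin) (k : nat) : int :=
  match t, k with
  | B3, 3 => 1 | B3, _ => 2
  | C3, 3 => 2
  | G2, 2 => 3
  | _, _ => 1
  end.

Definition root_form (t : dynkin) (i j : nat) : int :=
  symmetrizer t i * nth 0 (nth [::] (cartan_rows t) i.-1) j.-1.

(* The exponent of the whole diagram, times [edge_scale], is the weighted sum of the
   exponents of these pairs of neighbours. The multiplicities of the node
   [outer], which occurs in the first layer, and of [inner] are in units of
   [outer_unit] and [inner_unit]. *)
Record edge := Edge { outer : nat; inner : nat; weight : nat; outer_unit : nat; inner_unit : nat }.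

Definition edge_scale (c : example) : nat :=
  match c with
  | A5a => 6 | B3a | C3a | D4a => 3 | G2a => 1
  | A5b => 18 | B3b | C3b | D4b => 9 | G2b => 3
  end.

(** Each pair of neighbours occurs once, so its off-diagonal value fixes the weight: 3 * weight *
    outer_unit * inner_unit is minus [edge_scale] times the entry of [root_form]. That the diagonal
    values then fit is checked in [symmetrizer_edges]. *)
Definition edges (c : example) : seq edge :=
  match c with
  | A5a => [:: Edge 2 1 2 1 1; Edge 4 5 2 1 1; Edge 2 3 1 1 2; Edge 4 3 1 1 2]
  | A5b => [:: Edge 1 2 2 1 3; Edge 5 4 2 1 3; Edge 3 2 1 2 3; Edge 3 4 1 2 3]
  | B3a => [:: Edge 2 1 2 1 1; Edge 2 3 1 1 2]
  | B3b => [:: Edge 1 2 2 1 3; Edge 3 2 1 2 3]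
  | C3a => [:: Edge 2 1 1 1 1; Edge 2 3 2 1 1]
  | C3b => [:: Edge 1 2 1 1 3; Edge 3 2 2 1 3]
  | D4a => [:: Edge 2 1 1 1 1; Edge 2 3 1 1 1; Edge 2 4 1 1 1]
  | D4b => [:: Edge 1 2 1 1 3; Edge 3 2 1 1 3; Edge 4 2 1 1 3]
  | G2a => [:: Edge 1 2 1 1 1]
  | G2b => [:: Edge 2 1 1 1 3]
  end.

Definition edge_label (d : edge) (k : nat) : option nat :=
  if eqn k (outer d) then Some 0%N else if eqn k (inner d) then Some 1%N else None.

Definition edge_symmetrizer (d : edge) :=
  pull_symmetrizer (edge_label d) (edge_sym (outer_unit d) (inner_unit d)).

Definition edge_root_form (d : edge) :=
  pull_form (edge_label d) (edge_offdiag (outer_unit d) (inner_unit d)).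

Lemma edge_label_inj d i j k : edge_label d i = Some k -> edge_label d j = Some k -> i = j.
Proof.
rewrite /edge_label !eqnE.
case: (i =P outer d) => [->|_]; case: (j =P outer d) => [->|_] //.
- by case: ifP => // _ [<-].
- by case: ifP => // _ [<-].
by case: (i =P inner d) => [->|_]; case: (j =P inner d) => [->|_].
Qed.

Lemma symmetrizer_edges c i : labels (diagram c) i ->
  (edge_scale c)%:Z * symmetrizer (diagram c) i =
  \sum_(d <- edges c) (weight d)%:Z * edge_symmetrizer d i.
Proof.
by case: c; case: i => [|[|[|[|[|[|i]]]]]] //= _; rewrite !big_cons big_nil.
Qed.

Lemma root_form_edges c i j : labels (diagram c) i -> labels (diagram c) j -> i != j ->
  (edge_scale c)%:Z * root_form (diagram c) i j =
  \sum_(d <- edges c) (weight d)%:Z * edge_root_form d i j.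
Proof.
by case: c; case: i => [|[|[|[|[|[|i]]]]]] //= _;
  case: j => [|[|[|[|[|[|j]]]]]] //= _ _; rewrite !big_cons big_nil.
Qed.

(* The units of the nodes of the outer and of the inner layers, in the order of
   the word. *)
Definition outers (c : example) : seq nat :=
  match c with
  | A5a => [:: 1; 1] | A5b => [:: 1; 2; 1]
  | B3a | C3a | D4a | G2a | G2b => [:: 1]
  | B3b => [:: 1; 2] | C3b => [:: 1; 1] | D4b => [:: 1; 1; 1]
  end%N.

Definition inners (c : example) : seq nat :=
  match c with
  | A5a => [:: 1; 2; 1] | A5b => [:: 3; 3]
  | B3a => [:: 1; 2] | C3a => [:: 1; 1] | D4a => [:: 1; 1; 1] | G2a => [:: 1]
  | B3b | C3b | D4b | G2b => [:: 3]
  end%N.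

Definition theta_theta_mat (c : example) (l : nat) : seq (seq nat) :=
  [seq [:: p * l; 0]%N | p <- outers c] ++ [seq [:: s * l]%N | s <- inners c] ++
  [seq [:: 0; p * l]%N | p <- outers c].

Definition theta_xi_mat (c : example) (l : nat) : seq (seq nat) :=
  [seq [:: p * l; p * l; 0]%N | p <- outers c] ++
  [seq [:: s * l; s * l]%N | s <- inners c] ++
  [seq [:: 0; p * l; p * l]%N | p <- outers c].

Definition xi_xi_mat (c : example) (l t : nat) : seq (seq nat) :=
  [seq [:: p * (l - t); p * t; 0]%N | p <- outers c] ++
  [seq [:: s * (l - t); s * t]%N | s <- inners c] ++
  [seq [:: p * t; 2 * (p * (l - t)); p * t]%N | p <- outers c] ++
  [seq [:: s * t; s * (l - t)]%N | s <- inners c] ++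
  [seq [:: 0; p * t; p * (l - t)]%N | p <- outers c].

Fixpoint each (T : Type) (P : T -> Prop) (s : seq T) : Prop :=
  if s is x :: s' then P x /\ each P s' else True.

Lemma sum_locus (T : Type) (s : seq T) (x : T -> nat) (e : T -> int) (Z : T -> Prop) :
  each (fun d => (0 < x d)%N) s ->
  each (fun d => 0 <= e d /\ (e d = 0 <-> Z d)) s ->
  0 <= \sum_(d <- s) (x d)%:Z * e d /\
  (\sum_(d <- s) (x d)%:Z * e d = 0 <-> each Z s).
Proof.
elim: s => [|d s IH] /=; first by rewrite big_nil.
move=> [xd /IH{}IH] [[ed edZ] /IH[s0 sZ]]; rewrite big_cons.
have xe : 0 <= (x d)%:Z * e d by rewrite mulr_ge0.
split; first by rewrite addr_ge0.
rewrite -edZ -sZ; split=> [/eqP|[-> ->]]; last by rewrite mulr0.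
by rewrite paddr_eq0 // mulf_eq0 (gt_eqF (xd : 0 < (x d)%:Z)) /= => /andP[/eqP ? /eqP].
Qed.

Lemma each_impl (T : Type) (P Q : T -> Prop) (s : seq T) :
  (forall x, P x -> Q x) -> each P s -> each Q s.
Proof. by move=> PQ; elim: s => //= x s IH [/PQ ? /IH]. Qed.

(** The scaled exponent is a positive combination of the nonnegative exponents of the edges, so it
    vanishes exactly where all of them do. *)
Lemma edges_locus c w1 w2 (Z : edge -> seq (seq nat) -> Prop) :
  all (fun p => labels (diagram c) p.1) w1 -> all (fun p => labels (diagram c) p.1) w2 ->
  each (fun d => zero_locus (edge_sym (outer_unit d) (inner_unit d))
    (edge_offdiag (outer_unit d) (inner_unit d))
    (restr (edge_label d) w1) (restr (edge_label d) w2) (Z d)) (edges c) ->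
  zero_locus (symmetrizer (diagram c)) (root_form (diagram c)) w1 w2
    (fun M => each (fun d => Z d (restr_rows (edge_label d) w1 M)) (edges c)).
Proof.
move=> L1 L2 locus M hM; have D0 : 0 < (edge_scale c)%:Z by case: (c).
have E := matexp_linear M (@symmetrizer_edges c) (@root_form_edges c) L1 L2.
have [] := sum_locus (s := edges c) (x := weight)
  (e := fun d => matexp (edge_symmetrizer d) (edge_root_form d) w1 w2 M)
  (Z := fun d => Z d (restr_rows (edge_label d) w1 M)).
- by case: (c).
- apply: each_impl locus => d locd; rewrite restr_matexp ?(size_mats hM) //;
    last exact: edge_label_inj.
  by apply: locd; apply: restr_mats => //; apply: edge_label_inj.
rewrite -E pmulr_rge0 // => e0 <-; split=> //; split=> [->|/eqP]; first exact: mulr0.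
by rewrite mulf_eq0 gt_eqF //= => /eqP.
Qed.

Lemma restr_theta c l : each (fun d => restr (edge_label d) (theta_word c l) =
  edge_theta_word (outer_unit d) (inner_unit d) l) (edges c).
Proof. by case: c; rewrite /= /edge_theta_word ?mul1n. Qed.

Lemma restr_xi c l : each (fun d => restr (edge_label d) (xi_word c l) =
  edge_xi_word (outer_unit d) (inner_unit d) l) (edges c).
Proof. by case: c; rewrite /= /edge_xi_word ?mul1n ?mulnA. Qed.

Lemma edges_pos c : each (fun d => [/\ (0 < outer_unit d)%N, (0 < inner_unit d)%N &
  coprime (outer_unit d) (inner_unit d)]) (edges c).
Proof. by case: c; rewrite /=; do !split. Qed.

Lemma each_and (T : Type) (P Q : T -> Prop) (s : seq T) :
  each P s -> each Q s -> each (fun x => P x /\ Q x) s.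
Proof. by elim: s => //= x s IH [? /IH{}IH] [? /IH]. Qed.

Ltac solve_rows :=
  repeat match goal with M : seq (seq nat) |- _ =>
    destruct M as [|? M]; try discriminate end;
  cbv [restr_rows theta_word xi_word edge_label edges each eqn outer inner outer_unit inner_unit
    edge_theta_theta edge_theta_xi edge_xi_xi
    theta_theta_mat theta_xi_mat xi_xi_mat outers inners map cat];
  intros;
  repeat match goal with
  | H : _ /\ _ |- _ => destruct H
  | H : exists2 t, _ & _ |- _ => destruct H
  | H : _ :: _ = _ :: _ |- _ => injection H; clear H; intros; subst
  | H : (?k * ?t)%N = (?k * ?u)%N |- _ => is_var t; is_var u;
    first [ constr_eq t u; clear H
          | assert (t = u) by (clear - H; lia); subst ]
  end.

Lemma theta_theta_rows c l M : size M = size (theta_word c l) ->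
  each (fun d => restr_rows (edge_label d) (theta_word c l) M =
    edge_theta_theta (outer_unit d) (inner_unit d) l) (edges c) <-> M = theta_theta_mat c l.
Proof.
move=> sM; split=> [|->]; last by case: (c); do !split.
by case: c sM => /= sM; solve_rows.
Qed.

Lemma theta_xi_rows c l M : size M = size (theta_word c (2 * l)) ->
  each (fun d => restr_rows (edge_label d) (theta_word c (2 * l)) M =
    edge_theta_xi (outer_unit d) (inner_unit d) l) (edges c) <-> M = theta_xi_mat c l.
Proof.
move=> sM; split=> [|->]; last by case: (c); do !split.
by case: c sM => /= sM; solve_rows.
Qed.

(** Edges that share a node see the same rows there, with the same unit, so their parameters
    coincide; as the diagram is connected, a single t remains. *)
Lemma xi_xi_rows c l M : size M = size (xi_word c l) ->
  each (fun d => exists2 t, (t <= l)%N & restr_rows (edge_label d) (xi_word c l) M =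
    edge_xi_xi (outer_unit d) (inner_unit d) l t) (edges c) <->
  exists2 t, (t <= l)%N & M = xi_xi_mat c l t.
Proof.
move=> sM; split=> [|[t tl ->]]; last first.
  by case: (c); do !split; exists t.
by case: c sM => /= sM; solve_rows;
  match goal with
  | |- exists2 t, is_true (t <= _)%N & ((_ * (_ - ?t))%N :: _) :: _ = _ => exists t
  end.
Qed.

Lemma labels_theta c l : all (fun p => labels (diagram c) p.1) (theta_word c l).
Proof. by case: c. Qed.

Lemma labels_xi c l : all (fun p => labels (diagram c) p.1) (xi_word c l).
Proof. by case: c. Qed.

Lemma theta_theta_locus c l : (0 < l)%N ->
  zero_locus (symmetrizer (diagram c)) (root_form (diagram c))
    (theta_word c l) (theta_word c l) (fun M => M = theta_theta_mat c l).
Proof.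
move=> l0 M hM.
have [] := edges_locus (c := c)
  (Z := fun d M => M = edge_theta_theta (outer_unit d) (inner_unit d) l)
  (labels_theta c l) (labels_theta c l) _ hM.
  apply: each_impl (each_and (edges_pos c) (restr_theta c l)) => d [[p0 s0 _] ->].
  exact: edge_theta_theta_locus.
by rewrite theta_theta_rows // (size_mats hM).
Qed.

Lemma theta_xi_locus c l : (0 < l)%N ->
  zero_locus (symmetrizer (diagram c)) (root_form (diagram c))
    (theta_word c (2 * l)) (xi_word c l) (fun M => M = theta_xi_mat c l).
Proof.
move=> l0 M hM.
have [] := edges_locus (c := c) (Z := fun d M => M = edge_theta_xi (outer_unit d) (inner_unit d) l)
  (labels_theta c (2 * l)) (labels_xi c l) _ hM.
  apply: each_impl (each_and (edges_pos c)
    (each_and (restr_theta c (2 * l)) (restr_xi c l))) => d [[p0 s0 _] [-> ->]].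
  exact: edge_theta_xi_locus.
by rewrite theta_xi_rows // (size_mats hM).
Qed.

Lemma xi_xi_locus c l :
  zero_locus (symmetrizer (diagram c)) (root_form (diagram c))
    (xi_word c l) (xi_word c l) (fun M => exists2 t, (t <= l)%N & M = xi_xi_mat c l t).
Proof.
move=> M hM.
have [] := edges_locus (c := c)
  (Z := fun d M => exists2 t, (t <= l)%N & M = edge_xi_xi (outer_unit d) (inner_unit d) l t)
  (labels_xi c l) (labels_xi c l) _ hM.
  apply: each_impl (each_and (edges_pos c) (restr_xi c l)) => d [[p0 s0 ps] ->].
  exact: edge_xi_xi_locus.
by rewrite xi_xi_rows // (size_mats hM).
Qed.

(** * Membership and number of the zeros *)

Fixpoint is_split (i a : nat) (w : word) (r : seq nat) : bool :=
  if w is (j, b) :: w' then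
    if eqn i j then
      if r is c :: r' then [&& (c <= b)%N, (c <= a)%N & is_split i (a - c) w' r']
      else false
    else is_split i a w' r
  else (a == 0%N) && (if r is [::] then true else false).

(** Unfolds at an explicit matrix to linear conditions, so that membership in [mats] becomes a
    matter for [lia]. *)
Fixpoint is_mat (w1 w2 : word) (M : seq (seq nat)) : bool :=
  if w1 is (i, a) :: w1' then
    if M is r :: M' then is_split i a w2 r && is_mat w1' (residue i w2 r) M'
    else false
  else all (fun p => p.2 == 0%N) w2 && (if M is [::] then true else false).

Lemma mem_splits i a w r : is_split i a w r -> r \in splits i a w.
Proof.
elim: w a r => [|[j b] w IH] a r; first by rewrite /= => /andP[->]; case: r.
rewrite splits_cons [is_split _ _ _ _]/= -[eqn i j]/(i == j); case: ifP => // _; last exact: IH.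
case: r => // c r /and3P[cb ca hr]; apply/allpairsPdep; exists c, r; split=> //.
  by rewrite mem_filter ca mem_index_iota.
exact: IH.
Qed.

Lemma mem_mats w1 w2 M : is_mat w1 w2 M -> M \in mats w1 w2.
Proof.
elim: w1 w2 M => [|[i a] w1 IH] w2 M; first by rewrite /= => /andP[->]; case: M.
case: M => //= r M /andP[hr hM]; apply/allpairsPdep; exists r, M; split=> //.
  exact: mem_splits.
exact: IH.
Qed.

Ltac is_mat_tac :=
  apply: mem_mats;
  cbv [theta_theta_mat theta_xi_mat xi_xi_mat outers inners map cat theta_word xi_word];
  cbn [is_mat is_split residue eqn head behead all fst snd];
  repeat (apply/andP; split); lia.

Lemma theta_theta_mat_mem c l :
  theta_theta_mat c l \in mats (theta_word c l) (theta_word c l).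
Proof. case: c; is_mat_tac. Qed.

Lemma theta_xi_mat_mem c l :
  theta_xi_mat c l \in mats (theta_word c (2 * l)) (xi_word c l).
Proof. case: c; is_mat_tac. Qed.

Lemma xi_xi_mat_mem c l t : (t <= l)%N ->
  xi_xi_mat c l t \in mats (xi_word c l) (xi_word c l).
Proof. move=> tl; case: c; is_mat_tac. Qed.

(** [mats] has no repetitions, so the zeros found in it are a permutation of [s]. *)
Lemma zero_locus_count h kap w1 w2 (Z : seq (seq nat) -> Prop) (s : seq (seq (seq nat))) :
  zero_locus h kap w1 w2 Z -> uniq s -> {subset s <= mats w1 w2} ->
  (forall M, Z M <-> M \in s) ->
  count (fun M => matexp h kap w1 w2 M == 0) (mats w1 w2) = size s.
Proof.
move=> locus us sub ZE; rewrite -size_filter; apply/perm_size/uniq_perm => //.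
  by rewrite filter_uniq // mats_uniq.
move=> M; rewrite mem_filter; apply/andP/idP => [[/eqP e0 hM]|hM].
  by apply/ZE; apply/(locus M hM).2.
by have hM' := sub M hM; split=> //; apply/eqP/(locus M hM').2/ZE.
Qed.

Lemma xi_xi_mat_inj c l : injective (xi_xi_mat c l).
Proof.
move=> t u; case: c => -[] //; lia.
Qed.

(** * Residues of the terms of the sum *)

Lemma qX_neq1 m : (0 < m)%N -> q ^+ m != 1.
Proof.
move=> m0; rewrite /q -rmorphXn -tofrac1 tofrac_eq.
apply/eqP => /(congr1 (fun p : {poly rat} => size p)).
by rewrite size_polyXn size_poly1 => -[] E; rewrite E in m0.
Qed.

Lemma qnum_neq0_field (F : fieldType) (x : F) m : x != 0 ->
  (forall n, (0 < n)%N -> x ^+ n != 1) -> qnum x m.+1 != 0.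
Proof.
move=> x0 x1.
have H n : (0 < n)%N -> x ^+ n - x ^- n != 0.
  move=> n0; rewrite subr_eq0; apply: contra_neq (x1 (n + n)%N _).
    by move=> E; rewrite exprD {2}E mulfV // expf_neq0.
  by rewrite addn_gt0 n0.
by rewrite qnumE mulf_neq0 ?H // invr_neq0 // (H 1%N).
Qed.

Lemma qnum1_field (F : fieldType) (x : F) :
  (forall m, qnum x m.+1 != 0) -> qnum x 1 = 1.
Proof. by move=> hx; rewrite qnumE expr1 mulfV // vB_neq0. Qed.

(** Iterated, this gives v^m [m+1] = 1 + v^2 + ... + v^2m, which makes the residue 1 visible when v
    is a positive power of q. *)
Lemma qnumS_field (F : fieldType) (x : F) m : (forall m, qnum x m.+1 != 0) ->
  x ^+ m.+1 * qnum x m.+2 = x ^+ 2 * (x ^+ m * qnum x m.+1) + 1.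
Proof.
move=> hx; have x0 := v_neq0 hx.
rewrite -[m.+2]add1n (qnumD hx) (qnum1_field hx) mulr1 mulrDr mulfV ?expf_neq0 //.
by rewrite exprS; ring.
Qed.

Lemma qnum_neq0 k m : (0 < k)%N -> qnum (q ^+ k) m.+1 != 0.
Proof.
move=> k0; apply: qnum_neq0_field => [|n n0]; first exact/expf_neq0/q_neq0.
by rewrite -exprM; apply: qX_neq1; rewrite muln_gt0 k0 n0.
Qed.

Lemma mod_qA_divpow_norm k m : (0 < k)%N -> mod_qA 1 (divpow_norm (q ^+ k) m).
Proof.
move=> k0; have hk j := @qnum_neq0 k j k0.
elim: m => [|m IH]; first by rewrite divpow_norm0; apply: mod_qA11.
rewrite divpow_normS; apply: (mod_qAM1 IH); apply: mod_qA1V; elim: m {IH} => [|m IH].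
  by rewrite (qnum1_field hk) expr0 mul1r; apply: mod_qA11.
rewrite (qnumS_field m hk) -[X in mod_qA X _]add0r; apply: mod_qAD; last exact: mod_qA11.
rewrite -exprM; apply: (mod_qAM0 _ IH).
by apply: mod_qA_exp_gt0; rewrite muln_gt0 k0.
Qed.

(** A term with positive exponent lies in qA, and one with exponent 0 contributes its residue 1. *)
Lemma mod_qA_sum (T : eqType) (s : seq T) (e : T -> int) (w : T -> Qq) (m : nat) :
  (0 < m)%N -> {in s, forall x, 0 <= e x} -> {in s, forall x, mod_qA 1 (w x)} ->
  mod_qA (count (fun x => e x == 0) s)%:R (\sum_(x <- s) (q ^+ m) ^ e x * w x).
Proof.
move=> m0; elim: s => [|x s IH] he hw.
  by rewrite big_nil; apply: mod_qA00.
rewrite big_cons /= natrD; apply: mod_qAD; last first.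
  by apply: IH => y ys; [apply: he | apply: hw]; rewrite inE ys orbT.
have := he x (mem_head _ _); have := hw x (mem_head _ _).
case: (e x) => // -[|k] hx _; first by rewrite eqxx expr0z mul1r.
by apply: mod_qAM0 => //; rewrite -exprnP -exprM; apply: mod_qA_exp_gt0; rewrite muln_gt0 m0.
Qed.

(** * Application to the quantum group *)

Section Link.

Variables (n : nat) (a : 'M[int]_n) (b : invariant_form a).
Variables (e' : 'I_n -> {linear Uqm b -> Uqm b}) (B : {biscalar Uqm b}).
Hypothesis he' : kashiwara_operators e'.
Hypothesis hB : kashiwara_form e' B.

Variables (L : pred nat) (nd : nat -> 'I_n) (m : nat) (h : nat -> int) (kap : nat -> nat -> int).
Hypothesis m0 : (0 < m)%N.
Hypothesis nd_inj : {in L &, injective nd}.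
Hypothesis hE : forall i, L i -> b (nd i) (nd i) = 2 * (m%:Z * h i).
Hypothesis kapE : forall i j, L i -> L j -> h i * a (nd i) (nd j) = kap i j.

Lemma q_E (i : 'I_n) : exists2 k, (0 < k)%N & q_ b i = q ^+ k.
Proof.
case: (bil_diag b i) => k k0 bk; exists k => //.
by rewrite /q_ bk mulrC mulzK.
Qed.

Lemma qnum_q_neq0 (i : 'I_n) k : qnum (q_ b i) k.+1 != 0.
Proof. by case: (q_E i) => j j0 ->; apply: qnum_neq0. Qed.

Lemma cartan_diag (i : 'I_n) : a i i = 2.
Proof.
have b0 : b i i != 0 by case: (bil_diag b i) => k k0 ->; lia.
exact: (mulIf b0 (bil_cartan b i i)).
Qed.

Lemma qfactE i k : qfact b i k = qfactorial (q_ b i) k.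
Proof. by apply: eq_bigr => j _; rewrite qnumE. Qed.

Lemma divpowE i k : divpow b i k = dpow (fun i => f b i) (q_ b) i k.
Proof. by rewrite /divpow /dpow qfactE. Qed.

Lemma q_nd i : L i -> q_ b (nd i) = (q ^+ m) ^ h i.
Proof.
move=> Li; rewrite /q_ (hE Li) [2 * _]mulrC (@mulzK _ 2 isT) exprnP.
exact: esym (exprz_exp _ _ _).
Qed.

(** The base is v = q^m, where the given form is [m] times the one encoded by [h] and [kap]; every
    exponent scales by m and the zeros stay the same. *)
Lemma mod_qA_pairing w1 w2 :
  all (fun p => L p.1) w1 -> all (fun p => L p.1) w2 ->
  {in mats w1 w2, forall M, 0 <= matexp h kap w1 w2 M} ->
  mod_qA (count (fun M => matexp h kap w1 w2 M == 0) (mats w1 w2))%:R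
    (B (\prod_(p <- w1) divpow b (nd p.1) p.2) (\prod_(p <- w2) divpow b (nd p.1) p.2)).
Proof.
move=> Lw1 Lw2 ge0; case: hB => BC _ B11 Be; case: he' => e1 eM.
have q0 := q_neq0.
under [X in B X]eq_bigr do rewrite divpowE.
under [X in B _ X]eq_bigr do rewrite divpowE.
have := @B_wmon Qq (Uqm b) 'I_n (fun i => f b i) e' (q_ b) (fun i j => q_ b i ^ (- a i j))
  qnum_q_neq0 _ e1 eM (fun u v => B u v) _ _ _ Be BC B11 L nd (q ^+ m)
  h kap _ nd_inj q_nd _ w1 w2 Lw1 Lw2.
rewrite /wmon => ->.
- apply: mod_qA_sum => // M _; elim: w1 M {Lw1 ge0} => [|[i c] w1 IH] M /=.
    exact: mod_qA11.
  apply: mod_qAM1 => //; rewrite /row_wt; elim: (head _ _) => [|x r IHr].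
    by rewrite big_nil; apply: mod_qA11.
  rewrite big_cons; apply: mod_qAM1 => //.
  by case: (q_E (nd i)) => k k0 ->; apply: mod_qA_divpow_norm.
- by move=> i; rewrite cartan_diag exprnN.
- by move=> u v w; rewrite linearD.
- by move=> x u v; rewrite linearZl_LR.
- by move=> x u v; rewrite linearZ.
- by rewrite expf_neq0.
- by move=> i j Li Lj; rewrite q_nd // exprz_exp -(kapE Li Lj) mulrN.
Qed.

End Link.

(** * Nodes, normalization of the form, and conclusion *)

Lemma val_node t k : labels t k -> node t k = k.-1 :> nat.
Proof. by case: t => /andP[k0 kn]; rewrite /node inordK //= prednK. Qed.

Lemma node_inj t : {in labels t &, injective (node t)}.
Proof.
move=> i j Li Lj /(congr1 (@nat_of_ord _)); rewrite !val_node //.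
by case/andP: Li; case/andP: Lj; lia.
Qed.

Lemma cartan_node t i j : labels t i -> labels t j ->
  cartan t (node t i) (node t j) = nth 0 (nth [::] (cartan_rows t) i.-1) j.-1.
Proof. by move=> Li Lj; rewrite mxE !val_node. Qed.

(** Both a_ij b_ii and a_ji b_jj equal 2 (alpha_i, alpha_j), which carries the value at one node
    along the edges of the connected diagram. *)
Lemma bil_symmetrizer t (b : invariant_form (cartan t)) :
  exists2 m : nat, (0 < m)%N &
    forall i, labels t i -> b (node t i) (node t i) = 2 * (m%:Z * symmetrizer t i).
Proof.
have sym i j : labels t i -> labels t j ->
  nth 0 (nth [::] (cartan_rows t) i.-1) j.-1 * b (node t i) (node t i) =
  nth 0 (nth [::] (cartan_rows t) j.-1) i.-1 * b (node t j) (node t j).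
  by move=> Li Lj; rewrite -!cartan_node // !bil_cartan bil_sym.
(* Node 3 of B3 and node 1 of the others are short, so [symmetrizer] is 1 there and m can be read
   off. *)
have [m m0 bm] := bil_diag b (node t (if t is B3 then 3 else 1)%N).
exists m => //; case: t b sym bm => b sym /= bm.
- have := sym 1%N 2%N isT isT; have := sym 2%N 3%N isT isT; have := sym 3%N 4%N isT isT.
  have := sym 4%N 5%N isT isT; rewrite /= => E4 E3 E2 E1.
  by case=> [|[|[|[|[|[|i]]]]]] //= _; lia.
- have := sym 1%N 2%N isT isT; have := sym 2%N 3%N isT isT; rewrite /= => E2 E1.
  by case=> [|[|[|[|i]]]] //= _; lia.
- have := sym 1%N 2%N isT isT; have := sym 2%N 3%N isT isT; rewrite /= => E2 E1.
  by case=> [|[|[|[|i]]]] //= _; lia.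
- have := sym 1%N 2%N isT isT; have := sym 2%N 3%N isT isT; have := sym 2%N 4%N isT isT.
  rewrite /= => E3 E2 E1.
  by case=> [|[|[|[|[|i]]]]] //= _; lia.
- have := sym 1%N 2%N isT isT; rewrite /= => E1.
  by case=> [|[|[|i]]] //= _; lia.
Qed.

Theorem theorem4p6 (c : example)
    (b : invariant_form (cartan (diagram c)))
    (e' : 'I_(rank (diagram c)) -> {linear Uqm b -> Uqm b})
    (he' : kashiwara_operators e')
    (B : {biscalar Uqm b}) (hB : kashiwara_form e' B)
    (l : nat) (hl : (0 < l)%N) :
  [/\ mod_qA 1 (B (theta b l) (theta b l)),
      mod_qA 1 (B (theta b (2 * l)) (xi b l)) &
      mod_qA (l.+1)%:R (B (xi b l) (xi b l))].
Proof.
have [m m0 hE] := bil_symmetrizer b.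
have pairing w1 w2 Z s :
    all (fun p => labels (diagram c) p.1) w1 -> all (fun p => labels (diagram c) p.1) w2 ->
    zero_locus (symmetrizer (diagram c)) (root_form (diagram c)) w1 w2 Z ->
    uniq s -> {subset s <= mats w1 w2} -> (forall M, Z M <-> M \in s) ->
    mod_qA (size s)%:R (B (word_monomial b w1) (word_monomial b w2)).
  move=> L1 L2 locus us sub ZE; rewrite -(zero_locus_count locus us sub ZE).
  apply: (mod_qA_pairing he' hB m0 (@node_inj _) hE) => // [i j Li Lj|M hM].
    by rewrite cartan_node.
  by have [] := locus M hM.
split.
- have := pairing _ _ _ [:: theta_theta_mat c l] (labels_theta _ _) (labels_theta _ _)
    (@theta_theta_locus c l hl).
  rewrite mulr1n; apply=> //.
  + by move=> M; rewrite inE => /eqP->; apply: theta_theta_mat_mem.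
  + by move=> M; rewrite inE; split=> [->|/eqP].
- have := pairing _ _ _ [:: theta_xi_mat c l] (labels_theta _ _) (labels_xi _ _)
    (@theta_xi_locus c l hl).
  rewrite mulr1n; apply=> //.
  + by move=> M; rewrite inE => /eqP->; apply: theta_xi_mat_mem.
  + by move=> M; rewrite inE; split=> [->|/eqP].
(* The zeros are listed by t = 0, ..., l, which are l + 1 values. *)
rewrite -[l.+1](size_iota 0) -(size_map (xi_xi_mat c l)).
apply: pairing (labels_xi _ _) (labels_xi _ _) (@xi_xi_locus c l) _ _ _.
- by rewrite map_inj_uniq ?iota_uniq //; apply: xi_xi_mat_inj.
- move=> M /mapP[t]; rewrite mem_iota ltnS => tl ->; exact: xi_xi_mat_mem.
move=> M; split=> [[t tl ->]|/mapP[t]].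
  by apply: map_f; rewrite mem_iota ltnS.
by rewrite mem_iota ltnS => tl ->; exists t.
Qed.
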